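(* Let $\varphi$ be an onto endomorphism of a subshift $(X,\sigma)$. Let $i\in\mathbb N$ and $j\in\mathbb Z$. (1) $\varphi^i\sigma^j$ is essentially weakly LR and expansive if and only if $j/i>c_R(\varphi)$; and $\varphi^i\sigma^j$ is essentially weakly RL and expansive if and only if $j/i<c_L(\varphi)$. (2) When $(X,\sigma)$ is an SFT, if $\varphi$ is one-to-one or $\sigma$ is topologically transitive, then every ''weakly'' can be deleted in (1).
   Context: **Subshifts.** $\mathbb N=\{1,2,\dots\}$. An alphabet is a finite set with at least two elements. For an alphabet $A$, $A^{\mathbb Z}$ carries the product topology; the shift maps $(a_j)_j$ to $(a_{j+1})_j$. A subshift $(X,\sigma)$ over $A$ is a closed $X\subset A^{\mathbb Z}$ with $\sigma(X)=X$, $\sigma$ being the restricted shift; $d_X$ is a compatible metric; $L_k(X)$ is the set of words of length $k$ occurring in points of $X$. An endomorphism of $(X,\sigma)$ is a continuous map $\varphi:X\to X$ commuting with $\sigma$. **Type.** A local rule of neighborhood-size $N\ge 0$ on $X$ is a map $f:L_{N+1}(X)\to L_1(X)$ with $(f(a_j\dots a_{j+N}))_{j\in\mathbb Z}\in X$ for all $(a_j)\in X$. For $m,n\ge0$, $m+n=N$, $\varphi$ is of $(m,n)$-type given by $f$ if $\varphi((a_j)_j)=(f(a_{j-m}\dots a_{j+n}))_j$. Every endomorphism arises this way. **Degrees.** Let $f$ be a local rule of neighborhood-size $N$. It is $I$ left-redundant ($I\ge0$) if for all $(a_j),(b_j)\in X$, $a_j=b_j$ for all $j\ge0$ implies $f(a_{-I}\dots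 a_{-I+N})=f(b_{-I}\dots b_{-I+N})$; $I$ right-redundant if $a_j=b_j$ for all $j\le0$ implies $f(a_{I-N}\dots a_I)=f(b_{I-N}\dots b_I)$. It is strictly $I$ left-redundant if $I$ left-redundant but not $I+1$ left-redundant, strictly $\infty$ left-redundant if $I$ left-redundant for all $I\ge0$; similarly for right. It is $k$ right-mergible ($k\ge0$) if $a_j=b_j$ for $j\le 0$ and $f(a_{j-N}\dots a_j)=f(b_{j-N}\dots b_j)$ for $1\le j\le k+1$ imply $a_1=b_1$; $k$ left-mergible if $a_j=b_j$ for $j\ge0$ and $f(a_{-j}\dots a_{-j+N})=f(b_{-j}\dots b_{-j+N})$ for $1\le j\le k+1$ imply $a_{-1}=b_{-1}$. It is strictly $k$ right-mergible if $k\ge 0$ is the least integer for which it is $k$ right-mergible, strictly $\infty$ right-mergible if there is none; similarly for left. If $\varphi$ is of $(m,n)$-type given by $f$ which is strictly $I$ left-redundant, strictly $J$ right-redundant, strictly $k$ right-mergible and strictly $l$ left-mergible, then $P_L(\varphi)=I-m$, $P_R(\varphi)=J-n$, and, if $X$ is infinite, $Q_R(\varphi)=n-k$, $Q_L(\varphi)=m-l$; if $X$ is finite, $Q_R(\varphi)=Q_L(\varphi)=\infty$. These are independent of the choice of $f$, $m$, $n$. **Limits.** $p_L(\varphi)=\lim_{s\to\infty}P_L(\varphi^s)/s$, $p_R(\varphi)=\lim_{s\to\infty} P_R(\varphi^s)/s$, $q_R(\varphi)=\lim_{s\to\infty} Q_R(\varphi^s)/s$, $q_L(\varphi)=\lim_{s\to\infty}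 Q_L(\varphi^s)/s$; these limits exist in $\mathbb R\cup\{\pm\infty\}$. $c_R(\varphi)=\max\{-p_L(\varphi),-q_R(\varphi)\}$ and $c_L(\varphi)=\min\{p_R(\varphi),q_L(\varphi)\}$. **Graphs.** A graph is a finite directed graph $G$ (multiple arcs, loops allowed) with arc-set $A_G$, vertex-set $V_G$ and initial/terminal vertex maps $i_G,t_G:A_G\to V_G$; it is nondegenerate if $i_G,t_G$ are onto. $X_G\subset A_G^{\mathbb Z}$ is the set of bi-infinite paths ($t_G(a_j)=i_G(a_{j+1})$ for all $j$) and $\sigma_G$ its shift; for $G$ nondegenerate, $(X_G,\sigma_G)$ is called a topological Markov shift. An SFT is a subshift topologically conjugate to a topological Markov shift. A graph-homomorphism $h=(h_A,h_V):\Gamma\to G$ is a pair of maps on arcs and vertices compatible with $i,t$; it induces $\phi_h:X_\Gamma\to X_G$, $(\alpha_j)\mapsto(h_A(\alpha_j))$. $h$ is weakly left-resolving (resp. weakly right-resolving) if every arc $\alpha$ of $\Gamma$ is uniquely determined by $t_\Gamma(\alpha)$ (resp. $i_\Gamma(\alpha)$) and $h_A(\alpha)$; it is left-resolving (resp. right-resolving) if for every $u\in V_\Gamma$, $a\in A_G$ with $t_G(a)=h_V(u)$ (resp. $i_G(a)=h_V(u)$) there is a unique $\alpha\in A_\Gamma$ with $h_A(\alpha)=a$ and $t_\Gamma(\alpha)=u$ (resp. $i_\Gamma(\alpha)=u$). **Resolving endomorphisms.** A textile system $T=(p,q:\Gamma\to G)$ is a pair of graph-homomorphisms $p,q:\Gamma\to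 G$. $T$ is (weakly) LR if $p$ is (weakly) left-resolving and $q$ is (weakly) right-resolving; (weakly) RL if $p$ is (weakly) right-resolving and $q$ is (weakly) left-resolving. For $\mathcal P\in\{\text{LR},\text{RL}\}$: an endomorphism $\varphi$ of a subshift $(X,\sigma)$ is weakly $\mathcal P$ if there are a weakly $\mathcal P$ textile system $T=(p,q:\Gamma\to G)$ and a closed shift-invariant $Z\subset X_\Gamma$ such that $\phi_p|_Z$ is injective, $\phi_p(Z)=X$, $\phi_q(Z)\subset X$ and $\varphi=\phi_q\circ(\phi_p|_Z)^{-1}$. An onto endomorphism $\varphi$ of a topological Markov shift $(X_G,\sigma_G)$ is $\mathcal P$ if there is a $\mathcal P$ textile system $T=(p,q:\Gamma\to G)$ such that, with $Z_T$ the set of $z\in X_\Gamma$ for which there is $(z_i)_{i\in\mathbb Z}$ in $X_\Gamma$ with $z_0=z$ and $\phi_q(z_{i-1})=\phi_p(z_i)$ for all $i$, one has $\phi_p(Z_T)=X_G$, $\phi_p|_{Z_T}$ is injective and $\varphi=\phi_q\circ(\phi_p|_{Z_T})^{-1}$. An endomorphism $\varphi$ of $(X,\sigma)$ is essentially weakly $\mathcal P$ (resp. an onto endomorphism of an SFT is essentially $\mathcal P$) if there are a subshift (resp. topological Markov shift) $(X',\sigma')$, a weakly $\mathcal P$ (resp. $\mathcal P$) endomorphism $\varphi'$ of it and a homeomorphism $\theta:X\to X'$ with $\theta\sigma=\sigma'\theta$, $\theta\varphi=\varphi'\theta$. **Expansiveness.** An onto continuous map $\varphi:X\to X$ is expansive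 if there is $\delta>0$ such that for any sequences $(x_i)_{i\in\mathbb Z},(y_i)_{i\in\mathbb Z}$ in $X$ with $\varphi(x_i)=x_{i+1}$, $\varphi(y_i)=y_{i+1}$ for all $i$, $d_X(x_i,y_i)\le\delta$ for all $i\in\mathbb Z$ implies $(x_i)=(y_i)$. *)

(* Defs.v *)
From HB Require Import structures.
From mathcomp Require Import all_boot all_order all_algebra.
From mathcomp Require Import all_classical all_reals all_analysis.

Set Implicit Arguments.
Unset Strict Implicit.
Unset Printing Implicit Defensive.

Import Order.TTheory GRing.Theory Num.Theory.
Import numFieldNormedType.Exports.

Local Open Scope classical_set_scope.
Local Open Scope ring_scope.

Definition biseq (A : finType) : Type :=
  {ptws int -> discrete_topology A}.

HB.instance Definition _ (A : finType) := Nbhs.on (biseq A).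
HB.instance Definition _ (A : finType) := Topological.on (biseq A).

Section Subshifts.
Context {A : finType}.
Implicit Types (X : set (biseq A)) (phi : biseq A -> biseq A).

(* The power sigma^j of the shift, for j : int. *)
Definition shiftz (j : int) (x : biseq A) : biseq A := fun k => x (k + j).

Definition shift : biseq A -> biseq A := shiftz 1.

Definition subshift X : Prop :=
  [/\ (1 < #|A|)%N, closed X & shift @` X = X].

(* A self-map of X is represented by a total map of which only the restriction
   to X is relevant. *)
Definition endomorphism X phi : Prop :=
  [/\ set_fun X X phi,
      {within X, continuous phi} &
      forall x, X x -> phi (shift x) = shift (phi x)].

Definition transitive_shift X : Prop :=
  forall U V : set (biseq A), open U -> open V ->
    X `&` U !=set0 -> X `&` V !=set0 ->
    exists n : nat, (iter n shift @` (X `&` U)) `&` V !=set0.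

(* The last clause says that d induces the subspace topology on X. *)
Definition compatible_metric (R : realType) X
    (d : biseq A -> biseq A -> R) : Prop :=
  [/\ forall x y, X x -> X y -> (d x y = 0 <-> x = y),
      forall x y, X x -> X y -> d x y = d y x,
      forall x y z, X x -> X y -> X z -> d x z <= d x y + d y z &
      forall x, X x -> forall U : set (biseq A),
        within X (nbhs x) U <->
        exists2 e : R, 0 < e & forall y, X y -> d x y < e -> U y].

Definition expansive (R : realType) X (d : biseq A -> biseq A -> R) phi
    : Prop :=
  exists2 delta : R, 0 < delta &
    forall x y : int -> biseq A,
      (forall i, X (x i)) -> (forall i, X (y i)) ->
      (forall i, phi (x i) = x (i + 1)) -> (forall i, phi (y i) = y (i + 1)) ->
      (forall i, d (x i) (y i) <= delta) -> forall i, x i = y i.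

End Subshifts.

Section Degrees.
Context {A : finType} (X : set (biseq A)).

(* The word a_j ... a_(j+N). *)
Definition word (N : nat) (a : biseq A) (j : int) : N.+1.-tuple A :=
  [tuple a (j + (i : nat)%:Z) | i < N.+1].

Section LocalRule.
Variables (N : nat) (f : N.+1.-tuple A -> A).

(* A local rule is given by a total map on words; only its values on the words
   of length N+1 occurring in X are ever used, and the condition below forces
   these values to be letters occurring in X. *)
Definition local_rule : Prop :=
  forall a, X a -> X (fun j : int => f (word N a j)).

Definition left_redundant (I : nat) : Prop :=
  forall a b, X a -> X b -> (forall j : int, 0 <= j -> a j = b j) ->
    f (word N a (- I%:Z)) = f (word N b (- I%:Z)).

Definition right_redundant (I : nat) : Prop :=
  forall a b, X a -> X b -> (forall j : int, j <= 0 -> a j = b j) ->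
    f (word N a (I%:Z - N%:Z)) = f (word N b (I%:Z - N%:Z)).

Definition right_mergible (k : nat) : Prop :=
  forall a b, X a -> X b -> (forall j : int, j <= 0 -> a j = b j) ->
    (forall j : nat, (1 <= j <= k.+1)%N ->
       f (word N a (j%:Z - N%:Z)) = f (word N b (j%:Z - N%:Z))) ->
    a 1 = b 1.

Definition left_mergible (k : nat) : Prop :=
  forall a b, X a -> X b -> (forall j : int, 0 <= j -> a j = b j) ->
    (forall j : nat, (1 <= j <= k.+1)%N ->
       f (word N a (- j%:Z)) = f (word N b (- j%:Z))) ->
    a (-1) = b (-1).

End LocalRule.

(* Degrees are valued in option nat, with None standing for infinity. *)
Definition strictly_redundant (red : nat -> Prop) (I : option nat) : Prop :=
  if I is Some k then red k /\ ~ red k.+1 else forall k, red k.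

Definition strictly_mergible (mer : nat -> Prop) (k : option nat) : Prop :=
  if k is Some l then mer l /\ (forall l', (l' < l)%N -> ~ mer l')
  else forall l, ~ mer l.

Definition of_type (m n : nat) (f : (m + n).+1.-tuple A -> A)
    (phi : biseq A -> biseq A) : Prop :=
  local_rule f /\
  forall a, X a -> phi a = (fun j : int => f (word (m + n) a (j - m%:Z))).

Variable R : realType.
Local Open Scope ereal_scope.

Definition degree (k : option nat) : \bar R :=
  if k is Some l then l%:R%:E else +oo.

Definition PL (phi : biseq A -> biseq A) : \bar R :=
  [get v | exists m n (f : (m + n).+1.-tuple A -> A) I,
     [/\ of_type f phi, strictly_redundant (left_redundant f) I &
         v = degree I - m%:R%:E]].

Definition PR (phi : biseq A -> biseq A) : \bar R :=
  [get v | exists m n (f : (m + n).+1.-tuple A -> A) J,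
     [/\ of_type f phi, strictly_redundant (right_redundant f) J &
         v = degree J - n%:R%:E]].

Definition QR (phi : biseq A -> biseq A) : \bar R :=
  if `[< finite_set X >] then +oo else
  [get v | exists m n (f : (m + n).+1.-tuple A -> A) k,
     [/\ of_type f phi, strictly_mergible (right_mergible f) k &
         v = n%:R%:E - degree k]].

Definition QL (phi : biseq A -> biseq A) : \bar R :=
  if `[< finite_set X >] then +oo else
  [get v | exists m n (f : (m + n).+1.-tuple A -> A) l,
     [/\ of_type f phi, strictly_mergible (left_mergible f) l &
         v = m%:R%:E - degree l]].

Definition growth (P : (biseq A -> biseq A) -> \bar R)
    (phi : biseq A -> biseq A) : \bar R :=
  limn (fun s : nat => P (iter s phi) * (s%:R^-1)%:E).

Definition cR (phi : biseq A -> biseq A) : \bar R :=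
  maxe (- growth PL phi) (- growth QR phi).

Definition cL (phi : biseq A -> biseq A) : \bar R :=
  mine (growth PR phi) (growth QL phi).

End Degrees.

(* A finite directed graph whose arc-set is A. *)
Record graph (A : finType) := Graph {
  vert : finType;
  ini : A -> vert;
  ter : A -> vert
}.

Definition nondegenerate (A : finType) (G : graph A) : Prop :=
  (forall u : vert G, exists a, ini G a = u) /\
  (forall u : vert G, exists a, ter G a = u).

Definition paths (A : finType) (G : graph A) : set (biseq A) :=
  [set a : biseq A | forall j : int, ter G (a j) = ini G (a (j + 1))].

Record graph_hom (B A : finType) (Gam : graph B) (G : graph A) := GraphHom {
  harc : B -> A;
  hvert : vert Gam -> vert G;
  hom_ini : forall al, ini G (harc al) = hvert (ini Gam al);
  hom_ter : forall al, ter G (harc al) = hvert (ter Gam al)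
}.

Section Textile.
Context {B A : finType} {Gam : graph B} {G : graph A}.
Implicit Types h p q : graph_hom Gam G.

Definition induced h (z : biseq B) : biseq A := fun j => harc h (z j).

Definition weakly_left_resolving h : Prop :=
  forall al be, ter Gam al = ter Gam be -> harc h al = harc h be -> al = be.

Definition weakly_right_resolving h : Prop :=
  forall al be, ini Gam al = ini Gam be -> harc h al = harc h be -> al = be.

Definition left_resolving h : Prop :=
  forall (u : vert Gam) (a : A), ter G a = hvert h u ->
    exists! al : B, harc h al = a /\ ter Gam al = u.

Definition right_resolving h : Prop :=
  forall (u : vert Gam) (a : A), ini G a = hvert h u ->
    exists! al : B, harc h al = a /\ ini Gam al = u.

Definition textile_base p q : set (biseq B) :=
  [set z | exists zs : int -> biseq B,
     [/\ forall i, paths Gam (zs i), zs 0 = z &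
         forall i, induced q (zs (i - 1)) = induced p (zs i)]].

End Textile.

Inductive resolving_kind := LR | RL.

Definition weakly_textile (P : resolving_kind) (B A : finType)
    (Gam : graph B) (G : graph A) (p q : graph_hom Gam G) : Prop :=
  match P with
  | LR => weakly_left_resolving p /\ weakly_right_resolving q
  | RL => weakly_right_resolving p /\ weakly_left_resolving q
  end.

Definition textile (P : resolving_kind) (B A : finType)
    (Gam : graph B) (G : graph A) (p q : graph_hom Gam G) : Prop :=
  match P with
  | LR => left_resolving p /\ right_resolving q
  | RL => right_resolving p /\ left_resolving q
  end.

(* phi = phi_q o (phi_p|_Z)^-1 on the image of phi_p|_Z is written
   phi o phi_p = phi_q on Z.  Taking A itself as the arc-set of G loses nothing:
   arcs of G may be added or (if they occur neither in X nor in phi_q(Z))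
   removed freely. *)
Definition weakly_resolving (P : resolving_kind) (A : finType)
    (X : set (biseq A)) (phi : biseq A -> biseq A) : Prop :=
  endomorphism X phi /\
  exists (B : finType) (Gam : graph B) (G : graph A) (p q : graph_hom Gam G)
         (Z : set (biseq B)),
    [/\ weakly_textile P p q,
        [/\ closed Z, shift @` Z = Z & Z `<=` paths Gam],
        set_bij Z X (induced p),
        induced q @` Z `<=` X &
        forall z, Z z -> phi (induced p z) = induced q z].

Definition resolving (P : resolving_kind) (A : finType) (G : graph A)
    (phi : biseq A -> biseq A) : Prop :=
  [/\ endomorphism (paths G) phi, set_surj (paths G) (paths G) phi &
  exists (B : finType) (Gam : graph B) (p q : graph_hom Gam G),
    [/\ textile P p q,
        set_bij (textile_base p q) (paths G) (induced p) &
        forall z, textile_base p q z -> phi (induced p z) = induced q z]].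

Section Conjugacy.
Context {A A' : finType} {X : set (biseq A)} {X' : set (biseq A')}.

Definition homeomorphism (theta : X -> X') : Prop :=
  continuous theta /\
  exists theta' : X' -> X,
    [/\ continuous theta', cancel theta theta' & cancel theta' theta].

(* theta o phi = phi' o theta, for phi mapping X into X. *)
Definition intertwines (theta : X -> X') (phi : biseq A -> biseq A)
    (phi' : biseq A' -> biseq A') : Prop :=
  forall x y : X, set_val y = phi (set_val x) ->
    set_val (theta y) = phi' (set_val (theta x)).

End Conjugacy.

Definition SFT (A : finType) (X : set (biseq A)) : Prop :=
  subshift X /\
  exists (A' : finType) (G : graph A') (theta : X -> paths G),
    [/\ nondegenerate G, homeomorphism theta & intertwines theta shift shift].

Definition essentially_weakly (P : resolving_kind) (A : finType)
    (X : set (biseq A)) (phi : biseq A -> biseq A) : Prop :=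
  exists (A' : finType) (X' : set (biseq A')) (phi' : biseq A' -> biseq A')
         (theta : X -> X'),
    [/\ subshift X', weakly_resolving P X' phi', homeomorphism theta,
        intertwines theta shift shift & intertwines theta phi phi'].

Definition essentially (P : resolving_kind) (A : finType)
    (X : set (biseq A)) (phi : biseq A -> biseq A) : Prop :=
  exists (A' : finType) (G : graph A') (phi' : biseq A' -> biseq A')
         (theta : X -> paths G),
    [/\ nondegenerate G, resolving P G phi', homeomorphism theta,
        intertwines theta shift shift & intertwines theta phi phi'].

(* Main.v *)
(* Put psi = phi^i sigma^j.  The degree PL(psi) is the largest L such that the
   right half x_[0,oo) determines psi(x)_[-L,oo), and QR(psi) the largest L such
   that the left half x_(-oo,0] and psi(x)_(-oo,1-L] determine x_1.  Both are
   superadditive along powers, so by Fekete's lemma j/i > c_R(phi) means that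
   PL(psi^s) >= 1 and QR(psi^t) >= 1 for some s, t > 0 (for finite X both are
   automatic).

   If psi is conjugate to a weakly LR map, then PL and QR of all its powers are
   bounded below, and expansiveness, through compactness, improves the bound to 1
   for some power.  Conversely let PL(psi^S) >= 1 and QR(psi^S) >= 1, and let an
   arc be the pattern with rows x, psi(x), ..., psi^S(x) on W+1 columns, from its
   first W columns to its last W columns.  Deleting the last row is weakly left
   resolving, because for W large row 0 on columns 1, ..., W determines row S in
   column 0; deleting the first row is weakly right resolving, because rows 0 and
   S on columns 0, ..., W-1 determine row 0 in column W.  The rows 0, ..., S-1
   present a subshift conjugate to X.

   If X has finite type, the arcs missing for left resolvingness are obtained by
   gluing points.  So are those for right resolvingness when psi is injective,
   after applying psi^-1; when sigma is transitive one uses a label for which the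
   number of end vertices of its presentations is minimal.  The statements on RL
   follow by reflecting the sequences. *)

Require Import Defs.
From HB Require Import structures.
From mathcomp Require Import all_boot all_order all_algebra.
From mathcomp Require Import all_classical all_reals all_analysis.
From mathcomp Require Import zify ring.

Set Implicit Arguments.
Unset Strict Implicit.
Unset Printing Implicit Defensive.

Import Order.TTheory GRing.Theory Num.Theory.
Import numFieldNormedType.Exports.

Local Open Scope classical_set_scope.
Local Open Scope ring_scope.

(** * Topology and compactness in terms of finite windows *)

(** Integrality turns strict inequalities into a gain of a whole column: a positive slope of [psi]
    means that some power has degree at least 1. Only that power, [psi^S], is known to gain a
    column, so an arc has to remember the S rows in between.

    A conjugacy costs a fixed number of columns, whatever the power. Degrees at least 0 in the model
    thus become bounds -C uniform in the power, and expansiveness is asked for a widening that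
    exceeds all these losses.

    The obstacle is that [psi] may fail to be injective. Pasts of points are chosen by surjectivity,
    and merging is only asked of points that already agree far to the left. In finite type, gluing
    controls the rows obtained by applying [psi], which settles left resolvingness directly; an arc
    extending a pattern to the right is a preimage of a glued point, and its first row may differ
    from the prescribed one. An injective [psi] has a local inverse that fixes that row far to the
    left, whence merging repairs the rest. Otherwise only the labels of paths survive the choice of
    a preimage, and a counting argument on label sets replaces the construction of the arc. *)

Definition agree {A : Type} (a b : int) (x y : int -> A) : Prop :=
  forall k : int, a <= k <= b -> x k = y k.

Lemma cyl_nbhs (A : finType) (x : biseq A) (M : nat) :
  nbhs x [set y : biseq A | agree (- M%:Z) M%:Z x y].
Proof.
have coord k : nbhs x [set y : biseq A | x k = y k].
  have h := @proj_continuous int (fun _ => discrete_topology A) k x.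
  apply: (h [set a | x k = a]).
  by apply: filterS (discrete_set1 _) => a /= ->.
elim: M => [|M IH].
  by apply: filterS (coord 0) => y /= xy k k0; have -> : k = 0 by lia.
apply: filterS (filterI IH (filterI (coord (M.+1)%:Z) (coord (- (M.+1)%:Z)))).
move=> y /= [xy [xy1 xy2]] k kM.
have [->|kM1] := eqVneq k (M.+1)%:Z; first by [].
have [->|kM2] := eqVneq k (- (M.+1)%:Z); first by [].
by apply: xy; lia.
Qed.

(** The product topology is the supremum of the topologies pulled back along the coordinates, so it
    is enough that the filter generated by the cylinders around [x] converges to [x] for each of
    them. *)
Lemma nbhs_biseq (A : finType) (x : biseq A) (U : set (biseq A)) :
  nbhs x U <->
  exists M : nat, forall y, agree (- M%:Z) M%:Z x y -> U y.
Proof.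
split; last by case=> M MU; apply: filterS (cyl_nbhs x M).
pose G : set_system (biseq A) :=
  filter_from setT (fun M : nat => [set y : biseq A | agree (- M%:Z) M%:Z x y]).
have GF : Filter G.
  apply: filter_from_filter; first by exists 0%N.
  move=> M N _ _; exists (maxn M N) => // y /= xy.
  by split => k kM; apply: xy; lia.
have : G --> x.
  apply/cvg_sup => k V [_ [[W _ <-] Wx sWV]]; exists `|k|%N => // y /= xy.
  by apply: sWV => /=; rewrite -(xy k) //; lia.
by move=> h /h [M _ MU]; exists M.
Qed.

(* By compactness of the product, realised with an ultrafilter on nat. *)
Lemma cluster_seq (I : eqType) (A : finType) (u : nat -> I -> A) :
  exists v : I -> A, forall (s : seq I) (N : nat),
    exists2 n, (N <= n)%N & forall i, i \in s -> u n i = v i.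
Proof.
have [F [FU oF]] := @ultraFilterLemma nat (\oo) _.
have FP : ProperFilter F by exact: ultra_proper.
have pick i : exists a, F [set n | u n i = a].
  apply: contrapT => /forallNP nF.
  have {}nF a : F [set n | u n i <> a].
    by have [/nF|] := in_ultra_setVsetC [set n | u n i = a] FU.
  have : F [set n | u n i \notin enum A].
    elim: (enum A) => [|c s IH]; first by apply: filterS filterT.
    apply: filterS (filterI IH (nF c)) => n /= [nis /eqP nia].
    by rewrite inE negb_or nia.
  by move=> /filter_ex [n /=]; rewrite mem_enum.
exists (fun i => sval (cid (pick i))) => s N.
have : F [set n | (N <= n)%N /\ forall i, i \in s -> u n i = sval (cid (pick i))].
  have : F [set n | (N <= n)%N] by apply: oF; exists N.
  elim: s => [|i s IH] FN; first by apply: filterS FN => n /= ->.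
  apply: filterS (filterI (IH FN) (svalP (cid (pick i)))) => n /= [[-> h] e].
  by split=> // j; rewrite inE => /predU1P[->|/h].
by move=> /filter_ex [n [? ?]]; exists n.
Qed.

Definition window (M : nat) : seq int :=
  [seq i%:Z - M%:Z | i <- iota 0 (M + M).+1].

Lemma mem_window (M : nat) (k : int) : - M%:Z <= k <= M%:Z -> k \in window M.
Proof.
move=> kM; apply/mapP; exists `|(k + M%:Z)%R|%N; last lia.
by rewrite mem_iota; lia.
Qed.

Definition agreeL {A : Type} (b : int) (x y : int -> A) : Prop :=
  forall k : int, k <= b -> x k = y k.

Definition agreeR {A : Type} (a : int) (x y : int -> A) : Prop :=
  forall k : int, a <= k -> x k = y k.

(** Topology-free form of a closed shift-invariant set, used alike for [X], for path spaces and for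
    the sets [Z] of textile systems. The second clause is closedness. *)
Definition shift_closed {A : finType} (X : set (biseq A)) : Prop :=
  (forall x, X x -> forall j, X (shiftz j x)) /\
  (forall x, (forall M : nat, exists2 y, X y & agree (- M%:Z) M%:Z x y) -> X x).

Definition local_map {A A' : finType} (X : set (biseq A))
    (psi : biseq A -> biseq A') (r : nat) : Prop :=
  forall x y, X x -> X y -> forall k,
    agree (k - r%:Z) (k + r%:Z) x y -> psi x k = psi y k.

(** Endomorphisms in the form of the Curtis-Hedlund-Lyndon theorem: one radius serves all points and
    all columns. *)
Definition local_endo {A : finType} (X : set (biseq A))
    (psi : biseq A -> biseq A) : Prop :=
  [/\ forall x, X x -> X (psi x),
      exists r, local_map X psi r &
      forall x, X x -> forall j, psi (shiftz j x) = shiftz j (psi x)].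

Section Basics.
Context {A : finType}.
Implicit Types (X : set (biseq A)) (psi : biseq A -> biseq A) (x y : biseq A).

Lemma shiftzD i j x : shiftz i (shiftz j x) = shiftz (i + j) x.
Proof. by apply/funext => k; rewrite /shiftz addrA. Qed.

Lemma shiftz0 x : shiftz 0 x = x.
Proof. by apply/funext => k; rewrite /shiftz addr0. Qed.

Lemma shiftzK j : cancel (@shiftz A j) (shiftz (- j)).
Proof. by move=> x; rewrite shiftzD addNr shiftz0. Qed.

Lemma shiftzNK j : cancel (@shiftz A (- j)) (shiftz j).
Proof. by move=> x; rewrite shiftzD subrr shiftz0. Qed.

Lemma iter_shift n x : iter n Defs.shift x = shiftz n%:Z x.
Proof.
elim: n => [|n IH]; first by rewrite shiftz0.
by rewrite iterS IH /Defs.shift shiftzD -PoszD add1n.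
Qed.

Lemma agreeLW a b x y : b <= a -> agreeL a x y -> agreeL b x y.
Proof. by move=> ba xy k kb; apply: xy; lia. Qed.

Lemma agreeRW a b x y : a <= b -> agreeR a x y -> agreeR b x y.
Proof. by move=> ba xy k kb; apply: xy; lia. Qed.

Lemma agree_shift a b j x y :
  agree a b (shiftz j x) (shiftz j y) <-> agree (a + j) (b + j) x y.
Proof.
split=> xy k kab; last by apply: xy; lia.
by have := xy (k - j); rewrite /shiftz subrK; apply; lia.
Qed.

Lemma agreeL_shift b j x y :
  agreeL b (shiftz j x) (shiftz j y) <-> agreeL (b + j) x y.
Proof.
split=> xy k kab; last by apply: xy; lia.
by have := xy (k - j); rewrite /shiftz subrK; apply; lia.
Qed.

Lemma agreeR_shift b j x y :
  agreeR b (shiftz j x) (shiftz j y) <-> agreeR (b + j) x y.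
Proof.
split=> xy k kab; last by apply: xy; lia.
by have := xy (k - j); rewrite /shiftz subrK; apply; lia.
Qed.

Lemma shift_closed_of X : closed X -> Defs.shift @` X = X -> shift_closed X.
Proof.
move=> cX sX; have X1 x : X x -> X (shiftz 1 x).
  by move=> Xx; rewrite -sX; exists x.
have XN1 x : X x -> X (shiftz (-1) x).
  by rewrite -{1}sX => -[y Xy <-]; rewrite /Defs.shift shiftzK.
split=> [x Xx j|x xX].
  have XP n y : X y -> X (shiftz n%:Z y).
    elim: n => [|n IH] Xy; first by rewrite shiftz0.
    by rewrite -addn1 PoszD addrC -shiftzD; apply: X1; apply: IH.
  have XN n y : X y -> X (shiftz (- n%:Z) y).
    elim: n => [|n IH] Xy; first by rewrite shiftz0.
    by rewrite -addn1 PoszD addrC opprD -shiftzD; apply: XN1; apply: IH.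
  have [j0|j0] := leP 0 j; first by rewrite -(gez0_abs j0); apply: XP.
  have -> : j = - (`|j|%N)%:Z by lia.
  exact: XN.
apply: cX => U /nbhs_biseq[M MU]; have [y Xy xy] := xX M.
by exists y; split=> //; exact: MU.
Qed.

Lemma closed_of_shift_closed X : shift_closed X -> closed X /\ Defs.shift @` X = X.
Proof.
move=> [sX cX]; split=> [x clx|].
  apply: cX => M; have [y [Xy xy]] := clx _ (cyl_nbhs x M).
  by exists y.
apply/seteqP; split=> [_ [x Xx <-]|x Xx]; first exact: sX.
by exists (shiftz (-1) x); [exact: sX|rewrite /Defs.shift shiftzNK].
Qed.

Lemma subshift_shift_closed X : subshift X -> shift_closed X.
Proof. by move=> [_ cX sX]; exact: shift_closed_of. Qed.

(** Pairs of letters again form a finite alphabet, so one extraction handles both sequences with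
    common indices. *)
Lemma cluster_pair {A' : finType} X (X' : set (biseq A'))
    (u : nat -> biseq A) (v : nat -> biseq A') :
  shift_closed X -> shift_closed X' ->
  (forall n, X (u n)) -> (forall n, X' (v n)) ->
  exists (x : biseq A) (x' : biseq A'), [/\ X x, X' x' & forall M N : nat, exists n,
    [/\ (N <= n)%N, agree (- M%:Z) M%:Z x (u n)
      & agree (- M%:Z) M%:Z x' (v n)]].
Proof.
move=> [_ cX] [_ cX'] Xu Xv.
have [w hw] := cluster_seq (fun n (k : int) => (u n k, v n k)).
have H M N : exists n, [/\ (N <= n)%N, agree (- M%:Z) M%:Z (fun k => (w k).1) (u n)
      & agree (- M%:Z) M%:Z (fun k => (w k).2) (v n)].
  have [n Nn e] := hw (window M) N; exists n.
  by split=> // k /mem_window/e <-.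
exists (fun k => (w k).1), (fun k => (w k).2); split=> //.
  by apply: cX => M; have [n [_ h _]] := H M 0%N; exists (u n).
by apply: cX' => M; have [n [_ _ h]] := H M 0%N; exists (v n).
Qed.

Lemma cluster_point X (u : nat -> biseq A) :
  shift_closed X -> (forall n, X (u n)) ->
  exists2 x, X x & forall M N : nat, exists2 n,
    (N <= n)%N & agree (- M%:Z) M%:Z x (u n).
Proof.
move=> cX Xu; have [x [x' [Xx _ H]]] := cluster_pair cX cX Xu Xu.
by exists x => // M N; have [n [Nn xn _]] := H M N; exists n.
Qed.

Lemma local_mapW {A' : finType} X (psi : biseq A -> biseq A') r r' :
  (r <= r')%N -> local_map X psi r -> local_map X psi r'.
Proof.
by move=> rr' lr x y Xx Xy k xy; apply: lr => // l lk; apply: xy; lia.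
Qed.

(** Counterexamples for every radius, shifted to the origin, accumulate at a point [x], where the
    pointwise window [M] forces both values to equal [p 0]. Stated for a relation, the argument
    serves maps and both directions of a conjugacy. *)
Lemma uniformly_local {A' : finType} X (F : biseq A -> biseq A' -> Prop) :
  shift_closed X -> (forall x p, F x p -> X x) ->
  (forall x, X x -> exists p, F x p) ->
  (forall x p j, F x p -> F (shiftz j x) (shiftz j p)) ->
  (forall x p, F x p -> exists M : nat, forall y q, F y q ->
    agree (- M%:Z) M%:Z x y -> p 0 = q 0) ->
  exists r : nat, forall x p y q k, F x p -> F y q ->
    agree (k - r%:Z) (k + r%:Z) x y -> p k = q k.
Proof.
move=> cX FX XF Fs cF; apply: contrapT => /forallNP nr.
have {}nr (r : nat) : exists xy : (biseq A * biseq A') * (biseq A * biseq A'),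
    [/\ F xy.1.1 xy.1.2, F xy.2.1 xy.2.2, agree (- r%:Z) r%:Z xy.1.1 xy.2.1
      & xy.1.2 0 <> xy.2.2 0].
  apply: contrapT => /forallNP h; apply: (nr r) => x p y q k Fx Fy xy.
  apply: contrapT => ne.
  apply: (h ((shiftz k x, shiftz k p), (shiftz k y, shiftz k q))).
  split; [exact: Fs|exact: Fs| |by rewrite /shiftz /= add0r].
  by apply/agree_shift => l lk; apply: xy; lia.
have [u Hu] := choice nr.
have [x Xx hx] := cluster_point (u := fun n => (u n).1.1) cX
  (fun n => let: And4 h _ _ _ := Hu n in FX _ _ h).
have [p Fx] := XF x Xx; have [M hM] := cF x p Fx; have [n Mn xn] := hx M M.
have [F1 F2 u12 ne] := Hu n; apply: ne.
rewrite -(hM _ _ F1 xn) -(hM _ _ F2) // => k kM.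
by rewrite (xn _ kM) u12 //; lia.
Qed.

Lemma local_map_of_continuous {A' : finType} X (psi : biseq A -> biseq A') :
  shift_closed X ->
  (forall x, X x -> forall j, psi (shiftz j x) = shiftz j (psi x)) ->
  (forall x, X x -> exists M : nat, forall y, X y -> agree (- M%:Z) M%:Z x y ->
    psi x 0 = psi y 0) ->
  exists r, local_map X psi r.
Proof.
move=> cX ps cpsi.
have [||||r hr] := uniformly_local (F := fun x (p : biseq A') => X x /\ p = psi x) cX.
- by move=> x p [].
- by move=> x Xx; exists (psi x).
- by move=> x p j [Xx ->]; split; [case: cX => sX _; exact: sX|rewrite ps].
- move=> x p [Xx ->]; have [M hM] := cpsi x Xx.
  by exists M => y q [Xy ->]; exact: hM.
by exists r => x y Xx Xy k xy; apply: (hr x _ y).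
Qed.

Lemma endomorphism_local X psi :
  shift_closed X -> endomorphism X psi -> local_endo X psi.
Proof.
move=> cX [maps cpsi ps].
have psz x : X x -> forall j, psi (shiftz j x) = shiftz j (psi x).
  move=> Xx; have [sX _] := cX.
  have psP n y : X y -> psi (shiftz n%:Z y) = shiftz n%:Z (psi y).
    move=> Xy; elim: n => [|n IH]; first by rewrite !shiftz0.
    rewrite -addn1 PoszD addrC -!(shiftzD 1) -IH -/(Defs.shift (shiftz n _)) ps //.
    exact: sX.
  move=> j; have [j0|j0] := leP 0 j; first by rewrite -(gez0_abs j0); apply: psP.
  apply: (can_inj (shiftzNK j)); rewrite shiftzK.
  have -> : - j = (`|j|%N)%:Z by lia.
  rewrite -psP; last exact: sX.
  have -> : (`|j|%N)%:Z = - j by lia.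
  by rewrite shiftzK.
split=> //; apply: local_map_of_continuous => // x Xx.
have /subspace_continuousP/(_ x Xx) h := cpsi.
have /h := cyl_nbhs (psi x) 0.
rewrite nbhs_simpl /= => /nbhs_biseq[M hM].
exists M => y Xy xy; have /(_ Xy) := hM _ xy; apply; lia.
Qed.

Lemma local_endomorphism X psi : local_endo X psi -> endomorphism X psi.
Proof.
move=> [maps [r lr] ps]; split=> //; last by move=> x Xx; exact: ps.
apply/subspace_continuousP => x Xx U /nbhs_biseq[M hM].
rewrite nbhs_simpl /=; apply/nbhs_biseq; exists (M + r)%N => y xy Xy.
by apply: hM => k kM; apply: lr => // l lk; apply: xy; lia.
Qed.

Lemma local_endo_id X : local_endo X id.
Proof. by split=> //; exists 0%N => x y _ _ k; apply; lia. Qed.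

Lemma local_endo_comp X f g :
  local_endo X f -> local_endo X g -> local_endo X (f \o g).
Proof.
move=> [mf [r lf] sf] [mg [s lg] sg]; split=> [x /mg/mf //||x Xx j /=].
  exists (r + s)%N => x y Xx Xy k xy; apply: lf; [exact: mg|exact: mg|].
  by move=> l lk; apply: lg => // i il; apply: xy; lia.
by rewrite sg // sf //; exact: mg.
Qed.

Lemma local_endo_iter X f n : local_endo X f -> local_endo X (iter n f).
Proof.
move=> lf; elim: n => [|n IH]; first exact: local_endo_id.
have -> : iter n.+1 f = f \o iter n f by apply/funext => x; rewrite iterS.
exact: local_endo_comp.
Qed.

Lemma local_endo_shiftz X j : shift_closed X -> local_endo X (shiftz j).
Proof.
move=> [sX _]; split=> [x Xx||x _ i]; [exact: sX| |].
  by exists `|j|%N => x y _ _ k xy; apply: xy; lia.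
by rewrite !shiftzD addrC.
Qed.

Lemma surj_iter X f n : set_surj X X f -> set_surj X X (iter n f).
Proof.
move=> sf; elim: n => [|n IH] x Xx; first by exists x.
by have [y Xy <-] := sf x Xx; have [z Xz <-] := IH y Xy; exists z.
Qed.

End Basics.

(** * Expansiveness and the two determination properties *)

Definition biorbit {A : finType} (X : set (biseq A)) (psi : biseq A -> biseq A)
    (xs : int -> biseq A) : Prop :=
  (forall i, X (xs i)) /\ (forall i, psi (xs i) = xs (i + 1)).

Definition expansive_width {A : finType} (X : set (biseq A))
    (psi : biseq A -> biseq A) (M : nat) : Prop :=
  forall xs ys, biorbit X psi xs -> biorbit X psi ys ->
    (forall i, agree (- M%:Z) M%:Z (xs i) (ys i)) -> forall i, xs i = ys i.

(* For an endomorphism psi, [left_det X psi L] says that L <= PL(psi). *)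
Definition left_det {A : finType} (X : set (biseq A))
    (psi : biseq A -> biseq A) (L : int) : Prop :=
  forall x y, X x -> X y -> agreeR 0 x y -> psi x (- L) = psi y (- L).

(* For an endomorphism psi of an infinite X, [right_merge X psi L] says that
   L <= QR(psi). *)
Definition right_merge {A : finType} (X : set (biseq A))
    (psi : biseq A -> biseq A) (L : int) : Prop :=
  forall x y, X x -> X y -> agreeL 0 x y -> agreeL (1 - L) (psi x) (psi y) ->
    x 1 = y 1.

Definition LR_hyperbolic {A : finType} (X : set (biseq A))
    (psi : biseq A -> biseq A) : Prop :=
  (exists2 s, (0 < s)%N & left_det X (iter s psi) 1) /\
  (exists2 s, (0 < s)%N & right_merge X (iter s psi) 1).

Section Dynamics.
Context {A : finType} (X : set (biseq A)).
Hypothesis cX : shift_closed X.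
Implicit Types (f g psi : biseq A -> biseq A) (x y : biseq A).

Lemma left_detP psi L : local_endo X psi -> left_det X psi L ->
  forall b x y, X x -> X y -> agreeR b x y -> agreeR (b - L) (psi x) (psi y).
Proof.
move=> [_ _ sp] h b x y Xx Xy xy k kb; have [sX _] := cX.
have := h (shiftz (k + L) x) (shiftz (k + L) y) (sX _ Xx _) (sX _ Xy _).
rewrite !sp // /shiftz addrCA addNr addr0; apply.
by apply/agreeR_shift => l lk; apply: xy; lia.
Qed.

Lemma left_detW psi L L' : local_endo X psi -> L' <= L ->
  left_det X psi L -> left_det X psi L'.
Proof.
by move=> lp LL h x y Xx Xy xy; apply: (left_detP lp h Xx Xy xy); lia.
Qed.

Lemma left_det_comp f g L L' : local_endo X f -> local_endo X g ->
  left_det X f L -> left_det X g L' -> left_det X (f \o g) (L + L').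
Proof.
move=> lf lg hf hg x y Xx Xy xy; have [mg _ _] := lg.
have h := left_detP lg hg Xx Xy xy.
by apply: (left_detP lf hf (mg _ Xx) (mg _ Xy) h); lia.
Qed.

Lemma agreeL_local f r x y b : local_map X f r -> X x -> X y ->
  agreeL b x y -> agreeL (b - r%:Z) (f x) (f y).
Proof. by move=> lf Xx Xy xy k kb; apply: lf => // l lk; apply: xy; lia. Qed.

Lemma agreeR_local f r x y b : local_map X f r -> X x -> X y ->
  agreeR b x y -> agreeR (b + r%:Z) (f x) (f y).
Proof. by move=> lf Xx Xy xy k kb; apply: lf => // l lk; apply: xy; lia. Qed.

Lemma right_merge_step psi L : local_endo X psi -> right_merge X psi L ->
  forall t x y, X x -> X y -> agreeL t x y ->
    agreeL (t + 1 - L) (psi x) (psi y) -> agreeL (t + 1) x y.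
Proof.
move=> [_ _ sp] h t x y Xx Xy xy pxy; have [sX _] := cX.
have e := h (shiftz t x) (shiftz t y) (sX _ Xx _) (sX _ Xy _).
move=> k kt; have [->|kt1] := eqVneq k (1 + t); last by apply: xy; lia.
rewrite !sp // in e.
by apply: e; apply/agreeL_shift => l lt; [apply: xy|apply: pxy]; lia.
Qed.

(** Each step gains one column as long as the images agree far enough, and the starting bound [t]
    drops out of the conclusion. Composition relies on this: [g x] and [g y] are only known to agree
    up to a bound depending on the radius of [g]. *)
Lemma right_mergeP psi L : local_endo X psi -> right_merge X psi L ->
  forall t b x y, X x -> X y -> agreeL t x y -> agreeL b (psi x) (psi y) ->
    agreeL (b + L) x y.
Proof.
move=> lp h t b x y Xx Xy xy pxy.
have [n] : exists n : nat, b + L <= t + n%:Z by exists `|(b + L - t)%R|%N; lia.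
elim: n t xy => [|n IH] t xy bt; first by apply: agreeLW xy; lia.
have [bt0|bt0] := leP (b + L) t; first by apply: agreeLW xy.
apply: (IH (t + 1)); last lia.
by apply: (right_merge_step lp h) => //; apply: agreeLW pxy; lia.
Qed.

Lemma right_merge_of psi L :
  (forall x y, X x -> X y -> agreeL 0 x y -> agreeL (1 - L) (psi x) (psi y) ->
     agreeL 1 x y) -> right_merge X psi L.
Proof. by move=> h x y Xx Xy xy pxy; apply: (h x y). Qed.

Lemma right_mergeW psi L L' : L' <= L -> right_merge X psi L ->
  right_merge X psi L'.
Proof.
by move=> LL h x y Xx Xy xy pxy; apply: h => //; apply: agreeLW pxy; lia.
Qed.

Lemma right_merge_comp f g L L' : local_endo X f -> local_endo X g ->
  right_merge X f L -> right_merge X g L' -> right_merge X (f \o g) (L + L').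
Proof.
move=> lf lg hf hg; apply: right_merge_of => x y Xx Xy xy fxy.
have [mg [r lgr] _] := lg.
have gxy := agreeL_local lgr Xx Xy xy.
have h := right_mergeP lf hf (mg _ Xx) (mg _ Xy) gxy fxy.
by apply: agreeLW (right_mergeP lg hg Xx Xy xy h); lia.
Qed.

Lemma iterD_comp f m n : iter (m + n) f = iter m f \o iter n f.
Proof. by apply/funext => x; rewrite iterD. Qed.

Lemma iterM_comp (T : Type) (f : T -> T) m n : iter (m * n) f = iter m (iter n f).
Proof.
by elim: m => [|m IH]; apply/funext => x //; rewrite mulSn iterD IH iterS.
Qed.

Lemma left_det_iter f L n : local_endo X f -> left_det X f L ->
  left_det X (iter n f) (n%:Z * L).
Proof.
move=> lf h; elim: n => [|n IH].
  by rewrite mul0r => x y Xx Xy xy; apply: xy.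
rewrite -addn1 iterD_comp PoszD mulrDl mul1r.
apply: left_det_comp => //; exact: local_endo_iter.
Qed.

Lemma right_merge_iter f L n : local_endo X f -> right_merge X f L ->
  right_merge X (iter n f) (n%:Z * L).
Proof.
move=> lf h; elim: n => [|n IH].
  by rewrite mul0r => x y Xx Xy xy; apply; lia.
rewrite -addn1 iterD_comp PoszD mulrDl mul1r.
apply: right_merge_comp => //; exact: local_endo_iter.
Qed.

Lemma LR_hyperbolic_common psi : local_endo X psi -> LR_hyperbolic X psi ->
  exists S, [/\ (0 < S)%N, left_det X (iter S psi) 1
    & right_merge X (iter S psi) 1].
Proof.
move=> lp [[s s0 hs] [t t0 ht]]; exists (t * s)%N; split; first by rewrite muln_gt0 t0.
  rewrite iterM_comp; have ls := local_endo_iter s lp.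
  by apply: left_detW _ _ (left_det_iter t ls hs); [exact: local_endo_iter|lia].
rewrite mulnC iterM_comp; have lt := local_endo_iter t lp.
by apply: right_mergeW _ (right_merge_iter (n := s) lt ht); lia.
Qed.

(** By compactness: pairs violating the claim for every [R] accumulate at a pair agreeing on the
    whole half-line, and locality of [psi] transports the violation to this limit. *)
Lemma left_det_window psi L : local_endo X psi -> left_det X psi L ->
  exists R : nat, forall x y, X x -> X y -> agree 0 R%:Z x y ->
    psi x (- L) = psi y (- L).
Proof.
move=> [mp [r lp] sp] h; apply: contrapT => /forallNP nR.
have {}nR (R : nat) : exists xy : biseq A * biseq A,
    [/\ X xy.1, X xy.2, agree 0 R%:Z xy.1 xy.2 & psi xy.1 (- L) <> psi xy.2 (- L)].
  apply: contrapT => /forallNP H; apply: (nR R) => x y Xx Xy xy.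
  by apply: contrapT => ne; apply: (H (x, y)).
have [u Hu] := choice nR.
have [x [y [Xx Xy H]]] := cluster_pair (u := fun n => (u n).1) (v := fun n => (u n).2) cX cX
  (fun n => let: And4 a _ _ _ := Hu n in a) (fun n => let: And4 _ a _ _ := Hu n in a).
have xy : agreeR 0 x y.
  move=> k k0; have [n [kn xn yn]] := H `|k|%N `|k|%N.
  rewrite xn ?yn; [|lia|lia]; have [_ _ e _] := Hu n; apply: e; lia.
have [n [_ xn yn]] := H (`|L| + r)%N 0%N.
have [X1 X2 _ ne] := Hu n; apply: ne.
have ex : psi x (- L) = psi (u n).1 (- L) by apply: lp => // k kL; apply: xn; lia.
have ey : psi y (- L) = psi (u n).2 (- L) by apply: lp => // k kL; apply: yn; lia.
by rewrite -ex -ey; apply: h.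
Qed.

Lemma right_merge_window psi : local_endo X psi -> right_merge X psi 1 ->
  exists D : nat, forall x y, X x -> X y -> agree (- D%:Z) 0 x y ->
    agree (- D%:Z) 0 (psi x) (psi y) -> x 1 = y 1.
Proof.
move=> [mp [r lp] sp] h; apply: contrapT => /forallNP nR.
have {}nR (D : nat) : exists xy : biseq A * biseq A,
    [/\ X xy.1 /\ X xy.2, agree (- D%:Z) 0 xy.1 xy.2,
        agree (- D%:Z) 0 (psi xy.1) (psi xy.2) & xy.1 1 <> xy.2 1].
  apply: contrapT => /forallNP H; apply: (nR D) => x y Xx Xy xy pxy.
  by apply: contrapT => ne; apply: (H (x, y)).
have [u Hu] := choice nR.
have [x [y [Xx Xy H]]] := cluster_pair (u := fun n => (u n).1) (v := fun n => (u n).2) cX cX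
  (fun n => let: And4 (conj a _) _ _ _ := Hu n in a)
  (fun n => let: And4 (conj _ a) _ _ _ := Hu n in a).
have xy : agreeL 0 x y.
  move=> k k0; have [n [kn xn yn]] := H `|k|%N `|k|%N.
  rewrite xn ?yn; [|lia|lia]; have [_ e _ _] := Hu n; apply: e; lia.
have pxy : agreeL 0 (psi x) (psi y).
  move=> k k0; have [n [kn xn yn]] := H (`|k| + r)%N `|k|%N.
  have [[X1 X2] _ e _] := Hu n.
  have -> : psi x k = psi (u n).1 k by apply: lp => // l kl; apply: xn; lia.
  have -> : psi y k = psi (u n).2 k by apply: lp => // l kl; apply: yn; lia.
  by apply: e; lia.
have [n [_ xn yn]] := H 1%N 0%N.
have [_ _ _ ne] := Hu n; apply: ne.
by rewrite -xn // -yn //; apply: h.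
Qed.

Lemma biorbit_iter psi xs i n :
  biorbit X psi xs -> xs (i + n%:Z) = iter n psi (xs i).
Proof.
move=> [_ o]; elim: n => [|n IH]; first by rewrite addr0.
by rewrite iterS -IH o; congr xs; lia.
Qed.

Lemma biorbit_shift psi xs i j : local_endo X psi -> biorbit X psi xs ->
  biorbit X psi (fun l => shiftz j (xs (l + i))).
Proof.
move=> [_ _ sp] [Xxs o]; have [sX _] := cX; split=> l; first exact: sX.
by rewrite sp // o; congr (shiftz j (xs _)); lia.
Qed.

(** The future is given by [psi], the past by iterating a right inverse of [psi] on [X]. *)
Lemma biorbit_exists psi x : set_surj X X psi ->
  (forall z, X z -> X (psi z)) -> X x -> exists2 xs, biorbit X psi xs & xs 0 = x.
Proof.
move=> sp mp Xx.
have [g hg] : exists g, forall z, X z -> X (g z) /\ psi (g z) = z.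
  have /choice[g hg] : forall z, exists y, X z -> X y /\ psi y = z.
    by move=> z; have [/sp[y Xy yz]|nz] := pselect (X z); [exists y|exists z].
  by exists g.
have Xg n : X (iter n g x) by elim: n => // n IH; rewrite iterS; case: (hg _ IH).
have Xp n : X (iter n psi x) by elim: n => // n IH; rewrite iterS; apply: mp.
(* [Negz n] is the integer -(n+1), hence the [n.+1] backward steps. *)
exists (fun i : int => match i with
  | Posz n => iter n psi x | Negz n => iter n.+1 g x end) => //.
split=> [[n|n]|[n|n]]; [exact: Xp|exact: (Xg n.+1)| |].
  have -> : Posz n + 1 = Posz n.+1 by lia.
  by [].
case: n => [|n].
  have -> : Negz 0 + 1 = Posz 0 by lia.
  by rewrite /=; case: (hg _ Xx).
have -> : Negz n.+1 + 1 = Negz n by lia.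
by rewrite iterS; case: (hg _ (Xg n.+1)).
Qed.

(* The first property lets agreement on a strip of columns spread to the left, the
   second one then lets it spread to the right. *)
Lemma LR_hyperbolic_expansive psi : local_endo X psi -> LR_hyperbolic X psi ->
  exists M, expansive_width X psi M.
Proof.
move=> lp /(LR_hyperbolic_common lp)[S [S0 hL hR]].
have lS := local_endo_iter S lp.
have [R hLR] := left_det_window lS hL; exists R => xs ys oxs oys xy.
have [Xxs _] := oxs; have [Xys _] := oys; have [sX _] := cX.
have left n i : agree (- (R + n)%N%:Z) R%:Z (xs i) (ys i).
  elim: n i => [|n IH] i; first by rewrite addn0.
  move=> k kR; have [kRn|kRn] := leP (- (R + n)%N%:Z) k; first by apply: IH; lia.
  pose j := k + 1.
  have := hLR (shiftz j (xs (i - S%:Z))) (shiftz j (ys (i - S%:Z))) (sX _ (Xxs _) _)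
    (sX _ (Xys _) _).
  have [_ _ sp] := lS; rewrite !sp // -!biorbit_iter // !subrK /shiftz.
  have -> : -1 + j = k by lia.
  apply; apply/agree_shift => l lj; apply: IH; lia.
have leftR i : agreeL R%:Z (xs i) (ys i).
  by move=> k kR; apply: (left `|k|%N i); lia.
have right n i : agreeL (R + n)%N%:Z (xs i) (ys i).
  elim: n i => [|n IH] i; first by rewrite addn0.
  rewrite addnS -addn1 PoszD; apply: (right_merge_step lS hR) => //.
  by rewrite -!biorbit_iter //; apply: agreeLW (IH (i + S%:Z)); lia.
by move=> i; apply/funext => k; apply: (right `|k|%N i); lia.
Qed.

(** Compactness for pairs of bi-orbits, treated as arrays indexed by row and column: if every [W]
    failed, a limiting pair would agree on the strip at all times and so coincide, although its
    approximants differ in the window of radius [M']. *)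
Lemma expansive_window psi M : local_endo X psi -> expansive_width X psi M ->
  forall M' : nat, exists W : nat, forall xs ys, biorbit X psi xs -> biorbit X psi ys ->
    (forall i, - W%:Z <= i <= W%:Z -> agree (- M%:Z) M%:Z (xs i) (ys i)) ->
    agree (- M'%:Z) M'%:Z (xs 0) (ys 0).
Proof.
move=> [mp [r lp] _] hM M'; apply: contrapT => /forallNP nW.
have {}nW (W : nat) : exists xy : (int -> biseq A) * (int -> biseq A),
    [/\ biorbit X psi xy.1, biorbit X psi xy.2,
        forall i, - W%:Z <= i <= W%:Z -> agree (- M%:Z) M%:Z (xy.1 i) (xy.2 i) &
        ~ agree (- M'%:Z) M'%:Z (xy.1 0) (xy.2 0)].
  apply: contrapT => /forallNP H; apply: (nW W) => xs ys oxs oys xy.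
  by apply: contrapT => ne; apply: (H (xs, ys)).
have [u Hu] := choice nW.
have [v hv] := cluster_seq (fun n (p : int * int) => ((u n).1 p.1 p.2, (u n).2 p.1 p.2)).
pose x i k := (v (i, k)).1; pose y i k := (v (i, k)).2.
have H (I K N : nat) : exists n, [/\ (N <= n)%N,
    forall i, - I%:Z <= i <= I%:Z -> agree (- K%:Z) K%:Z (x i) ((u n).1 i) &
    forall i, - I%:Z <= i <= I%:Z -> agree (- K%:Z) K%:Z (y i) ((u n).2 i)].
  have [n Nn e] := hv [seq (i, k) | i <- window I, k <- window K] N; exists n.
  by split=> // i iI k kK; rewrite /x /y -e //;
     apply: allpairs_f; exact: mem_window.
have [_ clX] := cX.
have Xx i : X (x i).
  apply: clX => K; have [n [_ h _]] := H `|i|%N K 0%N; exists ((u n).1 i).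
    by have [[]] := Hu n.
  by apply: h; lia.
have Xy i : X (y i).
  apply: clX => K; have [n [_ _ h]] := H `|i|%N K 0%N; exists ((u n).2 i).
    by have [_ []] := Hu n.
  by apply: h; lia.
have ox : biorbit X psi x.
  split=> // i; apply/funext => k; have [n [_ h _]] := H (`|i| + 1)%N (`|k| + r)%N 0%N.
  have [[Xu o] _ _ _] := Hu n.
  rewrite h ?inE; [|lia|lia]; rewrite -o; apply: lp => // l lk; apply: h; lia.
have oy : biorbit X psi y.
  split=> // i; apply/funext => k; have [n [_ _ h]] := H (`|i| + 1)%N (`|k| + r)%N 0%N.
  have [_ [Xu o] _ _] := Hu n.
  rewrite h ?inE; [|lia|lia]; rewrite -o; apply: lp => // l lk; apply: h; lia.
have xy : forall i, agree (- M%:Z) M%:Z (x i) (y i).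
  move=> i k kM; have [n [ni h1 h2]] := H `|i|%N M `|i|%N.
  have [_ _ e _] := Hu n; rewrite h1 ?h2 //; [|lia|lia]; apply: e => //; lia.
have {}xy := hM _ _ ox oy xy.
have [n [_ h1 h2]] := H 0%N M' 0%N; have [_ _ _ ne] := Hu n; apply: ne => k kM.
by rewrite -h1 // -h2 // xy.
Qed.

(* The last two hypotheses say that PL(psi^s) and QR(psi^s) are bounded below
   uniformly in s. *)
Lemma LR_hyperbolic_of_bounds psi (C M : nat) : local_endo X psi -> set_surj X X psi ->
  expansive_width X psi M ->
  (forall s x y, X x -> X y -> agreeR 0 x y ->
     agreeR C%:Z (iter s psi x) (iter s psi y)) ->
  (forall s t x y, X x -> X y -> agreeL t x y ->
     agreeL 0 (iter s psi x) (iter s psi y) -> agreeL (- C%:Z) x y) ->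
  LR_hyperbolic X psi.
Proof.
move=> lp sp eM bL bR; have [mp [r lr] cp] := lp; have [sX _] := cX.
(* The widening pays for two losses of [C], for the half-width [M] of the strip, and for the one
   column to be gained. *)
have [W [W0 hW]] : exists W : nat, (0 < W)%N /\
    forall xs ys, biorbit X psi xs -> biorbit X psi ys ->
    (forall i, - W%:Z <= i <= W%:Z -> agree (- M%:Z) M%:Z (xs i) (ys i)) ->
    agree (- (C + C + M + 1)%N%:Z) (C + C + M + 1)%N%:Z (xs 0) (ys 0).
  have [W hW] := expansive_window lp eM (C + C + M + 1)%N.
  exists W.+1; split=> // xs ys ox oy xy; apply: hW => // i iW; apply: xy; lia.
(* Centring the time window at [W] turns the times -W, ..., W into the forward iterates 0, ..., 2W,
   which depend on [x] and [y] alone. *)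
have key x y (c : int) : X x -> X y ->
    (forall i : nat, (i <= W + W)%N ->
       agree (c - M%:Z) (c + M%:Z) (iter i psi x) (iter i psi y)) ->
    agree (c - (C + C + M + 1)%N%:Z) (c + (C + C + M + 1)%N%:Z)
      (iter W psi x) (iter W psi y).
  move=> Xx Xy xy.
  have [xs ox xs0] := biorbit_exists sp mp Xx.
  have [ys oy ys0] := biorbit_exists sp mp Xy.
  have h := hW _ _ (biorbit_shift W%:Z c lp ox) (biorbit_shift W%:Z c lp oy).
  have {}h : agree (- (C + C + M + 1)%N%:Z) (C + C + M + 1)%N%:Z
    (shiftz c (xs W%:Z)) (shiftz c (ys W%:Z)).
    apply: h => i iW; have -> : i + W%:Z = 0 + (`|(i + W%:Z)%R|%N)%:Z by lia.
    rewrite (biorbit_iter _ _ ox) (biorbit_iter _ _ oy) xs0 ys0; apply/agree_shift => k kc.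
    by apply: xy; lia.
  have -> : iter W psi x = xs W%:Z by rewrite -xs0 -(biorbit_iter _ _ ox) add0r.
  have -> : iter W psi y = ys W%:Z by rewrite -ys0 -(biorbit_iter _ _ oy) add0r.
  by move/agree_shift: h => h k kc; apply: h; lia.
split.
  exists W => // x y Xx Xy xy.
  apply: (key x y (C + M)%N%:Z) => //; last lia.
  by move=> i iW k kC; apply: (bL i x y Xx Xy xy); lia.
exists (W + W)%N; first by rewrite addn_gt0 W0.
apply: right_merge_of => x y Xx Xy xy pxy.
have asym (i : nat) (z z' : biseq A) t : X z -> X z' -> agreeL t z z' ->
    exists t', agreeL t' (iter i psi z) (iter i psi z').
  move=> Xz Xz' zz'; have [_ [ri lri] _] := local_endo_iter i lp.
  by exists (t - ri%:Z); exact: agreeL_local.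
have Xi i z : X z -> X (iter i psi z) by have [mi _ _] := local_endo_iter i lp; apply: mi.
(* From row [i] it takes [W + W - i] steps to reach the last row, where agreement is given; [bR]
   brings it back with a single loss of [C]. *)
have low (i : nat) : (i <= W + W)%N -> agreeL (- C%:Z) (iter i psi x) (iter i psi y).
  move=> iW; have [t ht] := asym i x y 0 Xx Xy xy.
  apply: (bR (W + W - i)%N t) => //; try exact: Xi.
  by rewrite -!iterD subnK // ; apply: agreeLW pxy.
(* A strip ending at column [-C] widens to column [C + 1] in row [W]. Applying [bR] once more, from
   row [W] back to row 0, leaves agreement up to column 1. *)
have mid : agreeL (C + 1)%N%:Z (iter W psi x) (iter W psi y).
  move=> k kC; have [kC'|kC'] := leP k (- C%:Z); first by apply: low => //; lia.
  apply: (key x y (- C%:Z - M%:Z)) => //; last lia.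
  by move=> i iW l lC; apply: low; lia.
have := bR W (- (C + 1)%N%:Z) (shiftz (C + 1)%N%:Z x) (shiftz (C + 1)%N%:Z y) (sX _ Xx _) (sX _ Xy _).
have [_ _ sW] := local_endo_iter W lp; rewrite !sW // => h.
have {}h : agreeL (- C%:Z) (shiftz (C + 1)%N%:Z x) (shiftz (C + 1)%N%:Z y).
  by apply: h; apply/agreeL_shift; [apply: agreeLW xy|apply: agreeLW mid]; lia.
by move/agreeL_shift: h => h k k1; apply: h; lia.
Qed.

End Dynamics.

(** * Expansiveness in a metric and in finite windows *)

Section Metric.
Context {R : realType} {A : finType} (X : set (biseq A)).
Variable d : biseq A -> biseq A -> R.
Hypotheses (cX : shift_closed X) (hd : compatible_metric X d).

Lemma metric_cyl x (M : nat) : X x ->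
  exists2 e : R, 0 < e & forall y, X y -> d x y < e -> agree (- M%:Z) M%:Z x y.
Proof.
move=> Xx; have [_ _ _ /(_ x Xx)h] := hd.
have /h : within X (nbhs x) [set y | agree (- M%:Z) M%:Z x y].
  by apply: filterS (cyl_nbhs x M).
by [].
Qed.

Lemma cyl_metric x (e : R) : X x -> 0 < e ->
  exists M : nat, forall y, X y -> agree (- M%:Z) M%:Z x y -> d x y < e.
Proof.
move=> Xx e0; have [_ _ _ /(_ x Xx)h] := hd.
have /h/nbhs_biseq[M hM] : exists2 e' : R, 0 < e' &
    forall y, X y -> d x y < e' -> [set y | d x y < e] y by exists e.
by exists M => y Xy xy; exact: hM.
Qed.

(** Compatibility compares [d] with windows only point by point. If pairs at distance tending to 0
    differed in the window, their first members would accumulate at some [x], and by the triangle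
    inequality both members would agree with [x] in that window. *)
Lemma metric_cyl_unif (M : nat) : exists2 e : R, 0 < e &
  forall x y, X x -> X y -> d x y <= e -> agree (- M%:Z) M%:Z x y.
Proof.
apply: contrapT => ne.
have {}ne (n : nat) : exists xy : biseq A * biseq A,
    [/\ X xy.1, X xy.2, d xy.1 xy.2 <= n.+1%:R^-1 &
        ~ agree (- M%:Z) M%:Z xy.1 xy.2].
  apply: contrapT => /forallNP H; apply: ne; exists n.+1%:R^-1.
    by rewrite invr_gt0 ltr0n.
  by move=> x y Xx Xy xy; apply: contrapT => ?; apply: (H (x, y)).
have [u Hu] := choice ne.
have [x Xx hx] := cluster_point (u := fun n => (u n).1) cX
  (fun n => let: And4 h _ _ _ := Hu n in h).
have [e e0 he] := metric_cyl M Xx.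
have e20 : 0 < e / 2 by rewrite divr_gt0.
have [K hK] := cyl_metric Xx e20.
have [N hN] : exists N : nat, N.+1%:R^-1 < e / 2 :> R.
  exists (Num.truncn (e / 2)^-1); rewrite invf_plt ?posrE ?ltr0n //.
  exact: truncnS_gt.
have [n Nn xn] := hx (maxn K M) N; have [X1 X2 dn nagr] := Hu n; apply: nagr => k kM.
have d1 : d x (u n).1 < e / 2 by apply: hK => // l lK; apply: xn; lia.
have d2 : d (u n).1 (u n).2 < e / 2.
  apply: le_lt_trans dn (le_lt_trans _ hN).
  by rewrite lef_pV2 ?posrE ?ltr0n // ler_nat.
have [_ _ tri _] := hd.
rewrite -xn; last lia.
apply: he => //; apply: le_lt_trans (tri _ _ _ Xx X1 X2) _.
by rewrite [ltRHS]splitr; exact: ltrD.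
Qed.

Lemma cyl_metric_unif (e : R) : 0 < e -> exists M : nat,
  forall x y, X x -> X y -> agree (- M%:Z) M%:Z x y -> d x y <= e.
Proof.
move=> e0; apply: contrapT => /forallNP ne.
have {}ne (n : nat) : exists xy : biseq A * biseq A,
    [/\ X xy.1, X xy.2, agree (- n%:Z) n%:Z xy.1 xy.2 & e < d xy.1 xy.2].
  apply: contrapT => /forallNP H; apply: (ne n) => x y Xx Xy xy.
  by rewrite leNgt; apply/negP => ?; apply: (H (x, y)).
have [u Hu] := choice ne.
have [x Xx hx] := cluster_point (u := fun n => (u n).1) cX
  (fun n => let: And4 h _ _ _ := Hu n in h).
have e20 : 0 < e / 2 by rewrite divr_gt0.
have [K hK] := cyl_metric Xx e20.
have [n Kn xn] := hx K K; have [X1 X2 agr] := Hu n; apply/negP; rewrite -leNgt.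
have [_ sym tri _] := hd.
apply: le_trans (tri _ _ _ X1 Xx X2) _.
rewrite [leRHS]splitr; apply: lerD; apply: ltW.
  by rewrite sym //; exact: hK.
by apply: hK => // k kK; rewrite xn // agr //; lia.
Qed.

Lemma expansive_widthP psi :
  expansive X d psi <-> exists M, expansive_width X psi M.
Proof.
split=> [[e e0 he]|[M hM]].
  have [M hM] := cyl_metric_unif e0; exists M => xs ys [Xxs ox] [Xys oy] xy.
  by apply: he => // i; apply: hM.
have [e e0 he] := metric_cyl_unif M; exists e => // xs ys Xxs Xys ox oy xy.
by apply: hM => // i; apply: he.
Qed.

End Metric.

(** * Degrees and their growth *)

(** For a downward closed [D], [v] is its supremum in the extended reals. *)
Definition is_degree {R : realType} (D : int -> Prop) (v : \bar R) : Prop :=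
  [\/ v = +oo%E /\ forall L, D L,
      exists L, [/\ v = (L%:~R)%:E, D L & ~ D (L + 1)] |
      v = -oo%E /\ forall L, ~ D L].

Lemma ereal_lt_real {R : realType} (x y : \bar R) : (x < y)%E ->
  exists a : R, ((x < a%:E) && (a%:E < y))%E.
Proof.
case: x => [x| |]; case: y => [y| |] // xy.
- by exists ((x + y) / 2); rewrite !lte_fin !midf_lt -?lte_fin.
- by exists (x + 1); rewrite lte_fin ltry ltrDl ltr01.
- by exists (y - 1); rewrite ltNyr lte_fin ltrBlDr ltrDl ltr01.
- by exists 0; rewrite ltNyr ltry.
Qed.

Section Fekete.
Context {R : realType} (u : nat -> \bar R) (D : nat -> int -> Prop).
Hypothesis D_mono : forall s L L', L' <= L -> D s L -> D s L'.
Hypothesis D0 : D 0 0.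
Hypothesis D_add : forall s t L L', D s L -> D t L' -> D (s + t)%N (L + L').
Hypothesis D_base : forall s L, (0 < s)%N -> D s L -> exists L0, D 1 L0.
Hypothesis uD : forall s, (0 < s)%N -> is_degree (D s) (u s).

Let w s : \bar R := (u s * (s%:R^-1)%:E)%E.

Let slope_gt s (a : R) : (0 < s)%N ->
  (a%:E < w s)%E <-> exists2 L, D s L & a * s%:R < L%:~R.
Proof.
move=> s0; have s0' : 0 < s%:R :> R by rewrite ltr0n.
rewrite /w; have [[-> DL]|[L [-> DL nDL]]|[-> nD]] := uD s0; split.
- move=> _; exists (Num.floor (a * s%:R) + 1) => //; exact: floorD1_gt.
- by move=> _; rewrite gt0_mulye ?ltry // lte_fin invr_gt0.
- by rewrite -EFinM lte_fin ltr_pdivlMr // => aL; exists L.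
- move=> [L' DL' aL']; rewrite -EFinM lte_fin ltr_pdivlMr //.
  apply: lt_le_trans aL' _; rewrite ler_int leNgt; apply/negP => LL'.
  by apply: nDL; apply: D_mono DL'; lia.
- by rewrite gt0_mulNye ?lte_fin ?invr_gt0.
- by move=> [L /nD].
Qed.

Let D_mul s L q : D s L -> D (q * s)%N (q%:Z * L).
Proof.
move=> DsL; elim: q => [|q IH]; first by rewrite mul0r.
by rewrite mulSn -addn1 PoszD mulrDl mul1r addrC; apply: D_add.
Qed.

(** Divide [n] by [s]: each full block gains [dl], while the remainder, paid with a value [L0] for
    exponent 1, costs at most [s * |L0 - a|] in total. [Q] blocks are enough for the gain to win. *)
Let slope_eventually s (a : R) : (0 < s)%N -> (a%:E < w s)%E ->
  exists N, forall n, (N <= n)%N -> (a%:E <= w n)%E.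
Proof.
move=> s0 /slope_gt -/(_ s0)[L DL aL].
have [L0 DL0] := D_base s0 DL.
have dl0 : 0 < L%:~R - a * s%:R by rewrite subr_gt0.
set dl := L%:~R - _ in dl0.
pose Q := (Num.truncn (s%:R * `|L0%:~R - a| / dl)).+2.
exists (Q * s)%N => n Qn.
have n0 : (0 < n)%N by apply: leq_trans Qn; rewrite muln_gt0 s0.
apply: ltW; apply/slope_gt => //.
exists ((n %/ s)%N%:Z * L + (n %% s)%N%:Z * L0).
  rewrite {1}(divn_eq n s); apply: D_add; first exact: D_mul.
  by have := D_mul (n %% s) DL0; rewrite muln1.
rewrite {1}(divn_eq n s) natrD natrM rmorphD !rmorphM /= !pmulrn.
rewrite -subr_gt0.
have -> : (n %/ s)%:R * L%:~R + (n %% s)%:R * L0%:~R -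
    a * ((n %/ s)%:R * s%:R + (n %% s)%:R)
  = (n %/ s)%:R * dl + (n %% s)%:R * (L0%:~R - a) :> R.
  by rewrite /dl; ring.
have h1 : (n %% s)%:R * (L0%:~R - a) >= - (s%:R * `|L0%:~R - a|) :> R.
  rewrite lerNl -mulrN.
  apply: (le_trans (y := (n %% s)%:R * `|L0%:~R - a|)).
    by apply: ler_wpM2l; rewrite ?ler0n // -normrN ler_norm.
  by apply: ler_wpM2r; rewrite ?normr_ge0 // ler_nat ltnW // ltn_mod.
apply: (lt_le_trans (y := (n %/ s)%:R * dl - s%:R * `|L0%:~R - a|)); last first.
  by rewrite lerD2l.
rewrite subr_gt0 -ltr_pdivrMr //.
apply: (lt_le_trans (truncnS_gt _)).
rewrite ler_nat leq_divRL //; apply: leq_trans Qn.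
by rewrite leq_mul2r /Q; apply/orP; right.
Qed.

(** By superadditivity the limit is the supremum of the slopes, so a strict inequality is witnessed
    by a single [s] with some [L] in [D s]. Then the integer [i * L + j * s] is positive, hence at
    least 1, which gives the threshold [1 - j * s] at exponent [i * s]. *)
Lemma growth_lt_slope (i : nat) (j : int) : (0 < i)%N ->
  ((- limn (fun s => u s * (s%:R^-1)%:E) < (j%:~R / i%:R)%:E)%E <->
   exists2 s, (0 < s)%N & D (i * s)%N (1 - j * s%:Z)).
Proof.
move=> i0; pose S := [set w s | s in [set s | (0 < s)%N]].
have wS s : (0 < s)%N -> (w s <= ereal_sup S)%E.
  by move=> s0; apply: ereal_sup_ubound; exists s.
have supE : ereal_sup (range (einfs w)) = ereal_sup S.
  apply/eqP; rewrite eq_le; apply/andP; split.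
    apply: ge_ereal_sup => _ [n _ <-]; apply: le_trans (wS n.+1 _) => //.
    by apply: ereal_inf_lbound; exists n.+1 => //=.
  apply: ge_ereal_sup => _ [s /= s0 <-].
  rewrite leNgt; apply/negP => lt_w.
  have [a /andP[lt_a a_lt]] : exists a : R,
      ((ereal_sup (range (einfs w)) < a%:E) && (a%:E < w s))%E.
    exact: ereal_lt_real.
  have [N hN] := slope_eventually s0 a_lt.
  move: lt_a; apply/negP; rewrite -leNgt.
  apply: (@le_trans _ _ (einfs w N)); last by apply: ereal_sup_ubound; exists N.
  by apply: le_ereal_inf_tmp => _ [n /= Nn <-]; exact: hN.
have w_cvg : w @ \oo --> ereal_sup S.
  apply: (@squeeze_cvge _ _ _ _ (einfs w) _ (cst (ereal_sup S))).
  (* The comparison starts at index 1, since the slope at index 0 is a division by zero and is left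
     out of [S]. *)
  - exists 1%N => // n /= n0; rewrite wS // andbT.
    by apply: ereal_inf_lbound; exists n => /=.
  - by rewrite -supE; exact: cvg_einfs_sup.
  - exact: cvg_cst.
rewrite -/w (cvg_lim _ w_cvg) // lteNl -EFinN.
have i0' : 0 < i%:R :> R by rewrite ltr0n.
split.
  move=> /ereal_sup_gt[_ [s /= s0 <-]] /slope_gt -/(_ s0)[L DL].
  rewrite mulNr mulrAC -mulNr ltr_pdivrMr // -subr_gt0 => h.
  exists s => //; apply: D_mono (D_mul i DL).
  have : 0 < i%:Z * L + j * s%:Z; last lia.
  rewrite -(ltr_int R) rmorphD !rmorphM /= -!pmulrn.
  by move: h; rewrite opprK [L%:~R * _]mulrC.
move=> [s s0 DL]; apply: lt_le_trans (wS (i * s)%N _); last by rewrite muln_gt0 i0.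
apply/slope_gt; first by rewrite muln_gt0 i0.
exists (1 - j * s%:Z) => //.
rewrite natrM mulrA mulNr divfK ?gt_eqF // rmorphB rmorphM /= -!pmulrn.
by rewrite mulNr addrC ltrDl.
Qed.
End Fekete.

(** * Reflection of bi-infinite sequences *)

Definition flip {A : finType} (x : biseq A) : biseq A := fun k => x (- k).

Definition flip_set {A : finType} (X : set (biseq A)) : set (biseq A) :=
  [set x | X (flip x)].

Definition flip_map {A : finType} (psi : biseq A -> biseq A) (x : biseq A) :
  biseq A := flip (psi (flip x)).

Section Flip.
Context {A : finType}.
Implicit Types (X : set (biseq A)) (psi : biseq A -> biseq A) (x y : biseq A).

Lemma flipK : involutive (@flip A).
Proof. by move=> x; apply/funext => k; rewrite /flip opprK. Qed.

Lemma flip_setK : involutive (@flip_set A).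
Proof. by move=> X; apply/funext => x; rewrite /flip_set /= flipK. Qed.

Lemma flip_mapK : involutive (@flip_map A).
Proof. by move=> psi; apply/funext => x; rewrite /flip_map !flipK. Qed.

Lemma flip_shiftz j x : flip (shiftz j x) = shiftz (- j) (flip x).
Proof.
apply/funext => k; rewrite /flip /shiftz; congr x; lia.
Qed.

Lemma flip_setE X x : X x -> flip_set X (flip x).
Proof. by rewrite /flip_set /= flipK. Qed.

Lemma flip_iter psi n : flip_map (iter n psi) = iter n (flip_map psi).
Proof.
apply/funext => x; elim: n => [|n IH]; first exact: flipK.
by rewrite iterS -IH /flip_map flipK.
Qed.

Lemma agree_flip a b x y : agree a b (flip x) (flip y) <-> agree (- b) (- a) x y.
Proof.
split=> xy k kab; last by apply: xy; lia.
by have := xy (- k); rewrite /flip opprK; apply; lia.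
Qed.

Lemma agreeL_flip b x y : agreeL b (flip x) (flip y) <-> agreeR (- b) x y.
Proof.
split=> xy k kab; last by apply: xy; lia.
by have := xy (- k); rewrite /flip opprK; apply; lia.
Qed.

Lemma agreeR_flip a x y : agreeR a (flip x) (flip y) <-> agreeL (- a) x y.
Proof.
split=> xy k kab; last by apply: xy; lia.
by have := xy (- k); rewrite /flip opprK; apply; lia.
Qed.

Lemma shift_closed_flip X : shift_closed X -> shift_closed (flip_set X).
Proof.
move=> [sX cX]; split=> [x Xx j|x h].
  by rewrite /flip_set /= flip_shiftz; exact: sX.
apply: cX => M; have [y Xy xy] := h M; exists (flip y) => //.
by apply/agree_flip => k kM; apply: xy; lia.
Qed.

Lemma local_map_flip X psi r :
  local_map X psi r -> local_map (flip_set X) (flip_map psi) r.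
Proof.
move=> lp x y Xx Xy k xy; rewrite /flip_map {1 3}/flip; apply: lp => //.
by apply/agree_flip => l lk; apply: xy; lia.
Qed.

Lemma local_endo_flip X psi :
  local_endo X psi -> local_endo (flip_set X) (flip_map psi).
Proof.
move=> [mp [r lp] sp]; split=> [x Xx||x Xx j].
- by apply: flip_setE; exact: mp.
- by exists r; exact: local_map_flip.
- by rewrite /flip_map flip_shiftz sp // flip_shiftz opprK.
Qed.

Lemma surj_flip X psi : set_surj X X psi ->
  set_surj (flip_set X) (flip_set X) (flip_map psi).
Proof.
move=> sp x Xx; have [y Xy yx] := sp _ Xx; exists (flip y); first exact: flip_setE.
by rewrite /flip_map flipK yx flipK.
Qed.

Lemma inj_flip X psi : set_inj X psi -> set_inj (flip_set X) (flip_map psi).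
Proof.
move=> ip x y /[!inE] Xx Xy /(can_inj flipK)/ip e.
by apply: (can_inj flipK); apply: e; rewrite inE.
Qed.

Lemma finite_set_flip X : finite_set X -> finite_set (flip_set X).
Proof.
move=> /(finite_image (@flip A)); apply: sub_finite_set => x Xx.
by exists (flip x) => //; rewrite flipK.
Qed.

Lemma biorbit_flip X psi xs : biorbit X psi xs ->
  biorbit (flip_set X) (flip_map psi) (fun i => flip (xs i)).
Proof.
move=> [Xx o]; split=> i; first exact: flip_setE.
by rewrite /flip_map flipK o.
Qed.

Lemma expansive_width_flip X psi M :
  expansive_width X psi M -> expansive_width (flip_set X) (flip_map psi) M.
Proof.
move=> h xs ys /biorbit_flip ox /biorbit_flip oy xy i.
rewrite flip_setK flip_mapK in ox oy.
apply: (can_inj flipK); apply: (h _ _ ox oy) => l.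
by apply/agree_flip; rewrite opprK.
Qed.

End Flip.

(** * Finite subshifts and determination by a half-line *)

Section Finiteness.
Context {A : finType} (X : set (biseq A)).
Hypothesis cX : shift_closed X.

(* If a window of length D+1 determines the next letter, then moving the window
   by one step is a well-defined surjection of the finite set of occurring
   words, hence a bijection, so the window determines the previous letter too. *)
Lemma finite_of_left_half :
  (forall x y, X x -> X y -> agreeL 0 x y -> x 1 = y 1) -> finite_set X.
Proof.
move=> h; have [sX _] := cX.
have [D hD] : exists D : nat, forall x y, X x -> X y -> agree (- D%:Z) 0 x y ->
    x 1 = y 1.
  have [|D hD] := @right_merge_window _ X cX id (local_endo_id X).
    by move=> x y Xx Xy xy _; exact: h.
  by exists D => x y Xx Xy xy; exact: (hD x y).
pose pat n (x : biseq A) : {ffun 'I_n -> A} := [ffun i => x (nat_of_ord i)%:Z].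
have patP n x y : pat n x = pat n y <-> agree 0 (n%:Z - 1) x y.
  split=> [/ffunP e k kn|xy]; last by apply/ffunP => i; rewrite !ffunE xy //; have := ltn_ord i; lia.
  have kn' : (`|k| < n)%N by lia.
  have := e (Ordinal kn'); rewrite !ffunE /=.
  by have -> : (`|k|%N)%:Z = k by lia.
have next k x y : X x -> X y -> agree k (k + D%:Z) x y -> x (k + D%:Z + 1) = y (k + D%:Z + 1).
  move=> Xx Xy xy; have := hD _ _ (sX _ Xx (k + D%:Z)) (sX _ Xy (k + D%:Z)).
  rewrite /shiftz [1 + _]addrC; apply.
  by apply/agree_shift => l lk; apply: xy; lia.
pose S : {set {ffun 'I_D.+2 -> A}} := [set t | `[< exists2 x, X x & t = pat D.+2 x >]]%SET.
pose hd (t : {ffun 'I_D.+2 -> A}) : {ffun 'I_D.+1 -> A} := [ffun i : 'I_D.+1 => t (inord i)].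
pose tl (t : {ffun 'I_D.+2 -> A}) : {ffun 'I_D.+1 -> A} := [ffun i : 'I_D.+1 => t (inord i.+1)].
have hdE x : hd (pat D.+2 x) = pat D.+1 x.
  by apply/ffunP => i; rewrite !ffunE inordK //; apply: leq_trans (ltn_ord i) _.
have tlE x : tl (pat D.+2 x) = pat D.+1 (shiftz 1 x).
  apply/ffunP => i; rewrite !ffunE inordK; last exact: (ltn_ord i).
  by rewrite /shiftz -PoszD addn1.
have SP x : X x -> pat D.+2 x \in S by move=> Xx; rewrite inE; apply/asboolP; exists x.
have hd_inj : {in S &, injective hd}.
  move=> s t; rewrite !inE => -[x Xx ->] [y Xy ->].
  rewrite !hdE => /patP xy.
  apply/patP => k kD; have [kD'|kD'] := leP k D%:Z; first by apply: xy; lia.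
  have -> : k = 0 + D%:Z + 1 by lia.
  by apply: next => // l lD; apply: xy; lia.
have hd_tl : hd @: S = tl @: S.
  apply/setP => t; apply/imsetP/imsetP => -[s]; rewrite inE => /asboolP[x Xx ->] ->.
    exists (pat D.+2 (shiftz (-1) x)); first by apply: SP; exact: sX.
    by rewrite hdE tlE shiftzNK.
  by exists (pat D.+2 (shiftz 1 x)); [apply: SP; exact: sX|rewrite hdE tlE].
have tl_inj : {in S &, injective tl}.
  by apply/imset_injP; rewrite -hd_tl; apply/eqP/card_in_imset.
have prev k x y : X x -> X y -> agree k (k + D%:Z) x y -> x (k - 1) = y (k - 1).
  move=> Xx Xy xy; pose x' := shiftz (k - 1) x; pose y' := shiftz (k - 1) y.
  have e : pat D.+2 x' = pat D.+2 y'.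
    apply: tl_inj; [apply: SP; exact: sX|apply: SP; exact: sX|].
    rewrite !tlE; apply/patP/agree_shift/agree_shift => l lD; apply: xy; lia.
  by move/patP: e => /(_ 0); rewrite /x' /y' /shiftz add0r; apply; lia.
have inj : {in X &, injective (pat D.+1)}.
  move=> x y /[!inE] Xx Xy /patP xy.
  have R n : agree 0 (D + n)%N%:Z x y.
    elim: n => [|n IH]; first by rewrite addn0 => k kD; apply: xy; lia.
    move=> k kD; have [kn|kn] := leP k (D + n)%N%:Z; first by apply: IH; lia.
    have -> : k = n%:Z + D%:Z + 1 by lia.
    by apply: next => // l ln; apply: IH; lia.
  have L n : agree (- n%:Z) D%:Z x y.
    elim: n => [|n IH]; first by move=> k kD; apply: xy; lia.
    move=> k kD; have [kn|kn] := leP (- n%:Z) k; first by apply: IH; lia.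
    have -> : k = - n%:Z - 1 by lia.
    by apply: prev => // l ln; apply: IH; lia.
  apply/funext => k; have [k0|k0] := leP 0 k; first by apply: (R `|k|%N); lia.
  by apply: (L `|k|%N); lia.
by rewrite -(eq_finite_set (inj_card_eq inj)); exact: finite_finset.
Qed.

(** By the pigeonhole principle the shift orbit of the pair (x, y) repeats, so [x] and [y] have a
    common period and every column can be moved into the left half. This matches the convention that
    the merging degrees of a finite [X] are infinite. *)
Lemma left_half_of_finite x y : finite_set X -> X x -> X y ->
  agreeL 0 x y -> x = y.
Proof.
move=> fX Xx Xy xy; have [sX _] := cX.
pose g (n : nat) := (shiftz n%:Z x, shiftz n%:Z y).
have [a [b [ab ea]]] : exists a b : nat, (a < b)%N /\ g a = g b.
  apply: contrapT => ng; apply: infinite_nat.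
  have ig : {in [set: nat] &, injective g}.
    move=> a b _ _ eab; case: (ltngtP a b) => // ab.
      by case: ng; exists a, b.
    by case: ng; exists b, a.
  rewrite -(eq_finite_set (inj_card_eq ig)).
  apply: sub_finite_set (finite_setX fX fX) => _ [n _ <-].
  by split; exact: sX.
have [ex ey] : shiftz a%:Z x = shiftz b%:Z x /\ shiftz a%:Z y = shiftz b%:Z y.
  by case: ea.
have per (z : biseq A) (k : int) (n : nat) : shiftz a%:Z z = shiftz b%:Z z ->
    z k = z (k - n%:Z * (b - a)%N%:Z).
  move=> ez; have st l : z l = z (l - (b - a)%N%:Z).
    have := congr1 (fun w : biseq A => w (l - b%:Z)) ez; rewrite /shiftz subrK => <-.
    by congr z; lia.
  elim: n => [|n ->]; first by rewrite mul0r subr0.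
  by rewrite st; congr z; lia.
apply/funext => k; rewrite (per x k `|k|%N) // (per y k `|k|%N) //; apply: xy.
by nia.
Qed.

End Finiteness.

Section Degrees.
Context {R : realType} {A : finType} (X : set (biseq A)).
Hypothesis cX : shift_closed X.
Implicit Types (phi : biseq A -> biseq A) (x y : biseq A).

Lemma word_eqP N (a b : biseq A) j :
  word N a j = word N b j <-> agree j (j + N%:Z) a b.
Proof.
split=> [e k kj|ab].
  have kN : (`|(k - j)%R| < N.+1)%N by lia.
  have := congr1 (fun t => tnth t (Ordinal kN)) e; rewrite !tnth_mktuple /=.
  by have -> : j + (`|(k - j)%R|%N)%:Z = k by lia.
apply: eq_from_tnth => i; rewrite !tnth_mktuple ab //.
have := ltn_ord i; lia.
Qed.

Lemma of_type_exists phi : local_endo X phi ->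
  exists m n (f : (m + n).+1.-tuple A -> A), of_type X f phi.
Proof.
move=> [mp [r lp] sp]; have [sX _] := cX; exists r, r.
have /choice[f hf] : forall t : (r + r).+1.-tuple A, exists c : A,
    forall a, X a -> word (r + r) a (- r%:Z) = t -> phi a 0 = c.
  move=> t; have [[a Xa at_]|na] :=
      pselect (exists2 a, X a & word (r + r) a (- r%:Z) = t).
    exists (phi a 0) => b Xb bt; apply: lp => // k kr.
    move/word_eqP: (etrans bt (esym at_)); apply; lia.
  (* A word that does not occur in [X] gets an arbitrary value, here its first letter. *)
  exists (tnth t ord0) => a Xa at_; by case: na; exists a.
have phif a : X a -> phi a = (fun j : int => f (word (r + r) a (j - r%:Z))).
  move=> Xa; apply/funext => j.
  have -> : phi a j = phi (shiftz j a) 0 by rewrite sp // /shiftz add0r.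
  apply: hf; first exact: sX.
  apply: eq_from_tnth => i; rewrite !tnth_mktuple /shiftz; congr (a _); lia.
(* A local rule reads its word from column [j] onwards, so it yields [phi a] shifted by [r]. *)
exists f; split=> // a Xa; have := sX _ (mp _ Xa) r%:Z; rewrite phif //.
by congr X; apply/funext => j; rewrite /shiftz addrK.
Qed.

Lemma redundant_degree (red : nat -> Prop) (D : int -> Prop) (m : nat) I :
  (forall L L', L' <= L -> D L -> D L') ->
  (forall k : nat, red k <-> D (k%:Z - m%:Z)) -> strictly_redundant red I ->
  is_degree D (degree R I - m%:R%:E)%E.
Proof.
move=> mono redD; case: I => [k [rk nrk]|rk] /=.
  constructor 2; exists (k%:Z - m%:Z); split; last first.
  - move=> h; apply: nrk; apply/redD; apply: mono h; lia.
  - exact/redD.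
  by rewrite -EFinB rmorphB /= !pmulrn.
constructor 1; split=> // L; apply: (mono (`|(L + m%:Z)%R|%N%:Z - m%:Z)); first lia.
exact/redD.
Qed.

(** Mergibility numbers start at 0 and can only express bounds [L <= n]. Excluding [D (n + 1)]
    ensures that a least number 0 means a supremum of exactly [n]. *)
Lemma mergible_degree (mer : nat -> Prop) (D : int -> Prop) (n : nat) k :
  (forall L L', L' <= L -> D L -> D L') -> ~ D (n%:Z + 1) ->
  (forall k : nat, mer k <-> D (n%:Z - k%:Z)) -> strictly_mergible mer k ->
  is_degree D (n%:R%:E - degree R k)%E.
Proof.
move=> mono nD merD; case: k => [k [mk nmk]|mk] /=.
  constructor 2; exists (n%:Z - k%:Z); split.
  - by rewrite -EFinB rmorphB /= !pmulrn.
  - exact/merD.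
  case: k mk nmk => [|k] mk nmk; first by rewrite subr0.
  move=> h; apply: (nmk k) => //; apply/merD; apply: mono h; lia.
constructor 3; split=> // L DL; have [Ln|Ln] := leP L n%:Z.
  by apply: (mk `|(n%:Z - L)%R|%N); apply/merD; apply: mono DL; lia.
by apply: nD; apply: mono DL; lia.
Qed.

Lemma strictly_redundant_exists (red : nat -> Prop) : red 0%N ->
  exists I, strictly_redundant red I.
Proof.
move=> r0; have [[k hk]|/forallNP h] := pselect (exists k, red k /\ ~ red k.+1).
  by exists (Some k).
exists None; elim=> // k rk; apply: contrapT => nk; exact: (h k).
Qed.

Lemma strictly_mergible_exists (mer : nat -> Prop) :
  exists k, strictly_mergible mer k.
Proof.
have [ex|/forallNP h] := pselect (exists k, mer k); last by exists None.
have ex' : exists k, `[< mer k >] by case: ex => k; exists k; exact/asboolP.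
exists (Some (ex_minn ex')); case: ex_minnP => k /asboolP mk km; split=> // l lk ml.
by have := km l; rewrite asboolT // => /(_ isT); rewrite leqNgt lk.
Qed.

Lemma agreeR_wordP m n (f : (m + n).+1.-tuple A -> A) phi a b (j : int) :
  of_type X f phi -> X a -> X b ->
  (f (word (m + n) a j) = f (word (m + n) b j) <->
   phi a (j + m%:Z) = phi b (j + m%:Z)).
Proof. by move=> [_ h] Xa Xb; rewrite !h // addrK. Qed.

Lemma left_redundantP m n (f : (m + n).+1.-tuple A -> A) phi (k : nat) :
  of_type X f phi -> left_redundant X f k <-> left_det X phi (k%:Z - m%:Z).
Proof.
move=> tf; split=> h a b Xa Xb ab.
  by move: (h a b Xa Xb ab) => /(agreeR_wordP _ tf Xa Xb); rewrite opprB addrC.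
by apply/(agreeR_wordP _ tf Xa Xb); rewrite addrC -opprB; apply: h.
Qed.

Lemma right_redundantP m n (f : (m + n).+1.-tuple A -> A) phi (k : nat) :
  of_type X f phi ->
  right_redundant X f k <->
  left_det (flip_set X) (flip_map phi) (k%:Z - n%:Z).
Proof.
move=> tf; split=> h a b Xa Xb ab.
  rewrite /flip_map /flip opprK -/(flip a) -/(flip b).
  have ab' : agreeL 0 (flip a) (flip b) by apply/agreeL_flip; rewrite oppr0.
  have := h _ _ Xa Xb ab' => /(agreeR_wordP _ tf Xa Xb).
  by have -> : k%:Z - (m + n)%N%:Z + m%:Z = k%:Z - n%:Z by lia.
apply/(agreeR_wordP _ tf Xa Xb).
have ab' : agreeR 0 (flip a) (flip b) by apply/agreeR_flip; rewrite oppr0.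
have := h (flip a) (flip b) (flip_setE Xa) (flip_setE Xb) ab'.
rewrite /flip_map !flipK /flip opprK.
by have -> : k%:Z - (m + n)%N%:Z + m%:Z = k%:Z - n%:Z by lia.
Qed.

Lemma of_type_agreeL m n (f : (m + n).+1.-tuple A -> A) phi a b :
  of_type X f phi -> X a -> X b -> agreeL 0 a b ->
  agreeL (- n%:Z) (phi a) (phi b).
Proof.
move=> [_ h] Xa Xb ab k kn; rewrite !h //; congr f; apply/word_eqP => l lk.
by apply: ab; lia.
Qed.

Lemma of_type_agreeR m n (f : (m + n).+1.-tuple A -> A) phi a b :
  of_type X f phi -> X a -> X b -> agreeR 0 a b ->
  agreeR m%:Z (phi a) (phi b).
Proof.
move=> [_ h] Xa Xb ab k kn; rewrite !h //; congr f; apply/word_eqP => l lk.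
by apply: ab; lia.
Qed.

Lemma right_mergibleP m n (f : (m + n).+1.-tuple A -> A) phi (k : nat) :
  of_type X f phi -> right_mergible X f k <-> right_merge X phi (n%:Z - k%:Z).
Proof.
move=> tf; split=> h a b Xa Xb ab.
  move=> pab; apply: (h a b) => // j jk; apply/(agreeR_wordP _ tf Xa Xb).
  by apply: pab; lia.
move=> fab; apply: (h a b) => // j jk.
(* Up to column [-n] the images agree because the left halves do; the later columns [j] are those
   tested by mergibility, under the index [j + n]. *)
have [jn|jn] := leP j (- n%:Z); first exact: (of_type_agreeL tf Xa Xb ab).
have := fab `|(j + n%:Z)%R|%N _; rewrite -/(is_true _).
move=> /(_ ltac:(lia)) /(agreeR_wordP _ tf Xa Xb).
by have -> : (`|(j + n%:Z)%R|%N)%:Z - (m + n)%N%:Z + m%:Z = j by lia.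
Qed.

Lemma left_mergibleP m n (f : (m + n).+1.-tuple A -> A) phi (k : nat) :
  of_type X f phi ->
  left_mergible X f k <->
  right_merge (flip_set X) (flip_map phi) (m%:Z - k%:Z).
Proof.
move=> tf; split=> h a b Xa Xb ab.
  move=> pab; have ab' : agreeR 0 (flip a) (flip b) by apply/agreeR_flip; rewrite oppr0.
  suff : flip a (-1) = flip b (-1) by rewrite /flip opprK.
  apply: (h (flip a) (flip b) Xa Xb ab') => j jk.
  apply/(agreeR_wordP _ tf Xa Xb).
  have -> : - j%:Z + m%:Z = - (j%:Z - m%:Z) by lia.
  by apply: pab; lia.
move=> fab; have ab' : agreeL 0 (flip a) (flip b) by apply/agreeL_flip; rewrite oppr0.
apply: (h (flip a) (flip b) (flip_setE Xa) (flip_setE Xb) ab') => j jk.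
rewrite /flip_map !flipK /flip.
have [jn|jn] := leP j (- m%:Z); first by apply: (of_type_agreeR tf Xa Xb ab); lia.
have := fab `|(j + m%:Z)%R|%N ltac:(lia) => /(agreeR_wordP _ tf Xa Xb).
by have -> : - (`|(j + m%:Z)%R|%N)%:Z + m%:Z = - j by lia.
Qed.

(** Left halves that agree have images agreeing up to column [-n], which is all that merging with
    [n + 1] asks for; the left half would then determine the next letter and [X] would be finite. *)
Lemma not_right_merge m n (f : (m + n).+1.-tuple A -> A) phi :
  of_type X f phi -> infinite_set X -> ~ right_merge X phi (n%:Z + 1).
Proof.
move=> tf iX h; apply: iX; apply: finite_of_left_half => // x y Xx Xy xy.
apply: h => //; have := of_type_agreeL tf Xx Xy xy.
by apply: agreeLW; lia.
Qed.

Lemma not_left_merge m n (f : (m + n).+1.-tuple A -> A) phi :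
  of_type X f phi -> infinite_set X ->
  ~ right_merge (flip_set X) (flip_map phi) (m%:Z + 1).
Proof.
move=> tf iX h; apply: iX; rewrite -(flip_setK X); apply: finite_set_flip.
apply: finite_of_left_half => [|x y Xx Xy xy]; first exact: shift_closed_flip.
apply: h => //; apply/agreeL_flip.
have xy' : agreeR 0 (flip x) (flip y) by apply/agreeR_flip; rewrite oppr0.
have := of_type_agreeR tf Xx Xy xy'.
by apply: agreeRW; lia.
Qed.

Lemma right_merge_finite phi L : finite_set X -> right_merge X phi L.
Proof. by move=> fX x y Xx Xy xy _; rewrite (left_half_of_finite cX fX Xx Xy xy). Qed.

(** [get] picks an unspecified representation by a local rule, but every representation gives the
    supremum of the same predicate, which mentions [phi] only. *)
Lemma PL_degree phi : local_endo X phi -> is_degree (left_det X phi) (PL X R phi).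
Proof.
move=> lp; set P := (X in is_degree _ (get X)).
suff /getPex[m [n [f [I [tf sI ->]]]]] : exists v, P v.
  apply: redundant_degree sI => [L L'|k]; [exact: left_detW|exact: left_redundantP].
have [m [n [f tf]]] := of_type_exists lp.
have [|I sI] := @strictly_redundant_exists (left_redundant X f).
  apply/(left_redundantP _ tf) => a b Xa Xb ab.
  by apply: (of_type_agreeR tf Xa Xb ab); lia.
by exists (degree R I - m%:R%:E)%E, m, n, f, I.
Qed.

Lemma PR_degree phi : local_endo X phi ->
  is_degree (left_det (flip_set X) (flip_map phi)) (PR X R phi).
Proof.
move=> lp; set P := (X in is_degree _ (get X)).
suff /getPex[m [n [f [I [tf sI ->]]]]] : exists v, P v.
  apply: redundant_degree sI => [L L'|k]; last exact: right_redundantP.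
  apply: left_detW; [exact: shift_closed_flip|exact: local_endo_flip].
have [m [n [f tf]]] := of_type_exists lp.
have [|I sI] := @strictly_redundant_exists (right_redundant X f).
  apply/(right_redundantP _ tf) => a b Xa Xb ab.
  rewrite /flip_map /flip; have ab' : agreeL 0 (flip a) (flip b).
    by apply/agreeL_flip; rewrite oppr0.
  by apply: (of_type_agreeL tf Xa Xb ab'); lia.
by exists (degree R I - n%:R%:E)%E, m, n, f, I.
Qed.

Lemma QR_degree phi : local_endo X phi ->
  is_degree (right_merge X phi) (QR X R phi).
Proof.
move=> lp; rewrite /QR; case: asboolP => fX.
  by constructor 1; split=> // L; exact: right_merge_finite.
set P := (X in is_degree _ (get X)).
suff /getPex[m [n [f [k [tf sk ->]]]]] : exists v, P v.
  apply: mergible_degree sk => [L L'||k']; [exact: right_mergeW| |exact: right_mergibleP].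
  exact: not_right_merge tf _.
have [m [n [f tf]]] := of_type_exists lp.
have [k sk] := strictly_mergible_exists (right_mergible X f).
by exists (n%:R%:E - degree R k)%E, m, n, f, k.
Qed.

End Degrees.

Lemma QL_degree {R : realType} {A : finType} (X : set (biseq A)) phi :
  shift_closed X -> local_endo X phi ->
  is_degree (right_merge (flip_set X) (flip_map phi)) (QL X R phi).
Proof.
move=> cX lp; rewrite /QL; case: asboolP => fX.
  constructor 1; split=> // L; apply: right_merge_finite; first exact: shift_closed_flip.
  exact: finite_set_flip.
set P := (X in is_degree _ (get X)).
suff /getPex[m [n [f [k [tf sk ->]]]]] : exists v, P v.
  apply: mergible_degree sk => [L L'||k']; [exact: right_mergeW| |exact: left_mergibleP].
  exact: not_left_merge tf _.
have [m [n [f tf]]] := of_type_exists cX lp.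
have [k sk] := strictly_mergible_exists (left_mergible X f).
by exists (m%:R%:E - degree R k)%E, m, n, f, k.
Qed.

(** * From growth rates to powers of the mixed map *)

Section Slope.
Context {R : realType} {A : finType} (X : set (biseq A)).
Hypothesis cX : shift_closed X.
Variable phi : biseq A -> biseq A.
Hypothesis lphi : local_endo X phi.
Variables (i : nat) (j : int).
Hypothesis i0 : (0 < i)%N.

Let psi (x : biseq A) := iter i phi (shiftz j x).

Lemma local_endo_mix : local_endo X psi.
Proof.
have -> : psi = iter i phi \o shiftz j by [].
apply: local_endo_comp; first exact: local_endo_iter.
exact: local_endo_shiftz.
Qed.

Let iter_psi s x : X x -> iter s psi x = shiftz (j * s%:Z) (iter (i * s) phi x).
Proof.
move=> Xx; have [mi _ si] := local_endo_iter i lphi.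
have Xis s' : X (iter (i * s') phi x).
  by have [m _ _] := local_endo_iter (i * s') lphi; apply: m.
elim: s => [|s IH]; first by rewrite mulr0 muln0 shiftz0.
have [sX _] := cX.
rewrite iterS IH /psi shiftzD si // mulnS iterD;
by have <- : j + j * s%:Z = j * s.+1%:Z by lia.
Qed.

Let left_det_psi s L : left_det X (iter s psi) L <->
  left_det X (iter (i * s) phi) (L - j * s%:Z).
Proof.
split=> h x y Xx Xy xy; have := h x y Xx Xy xy; rewrite !iter_psi // /shiftz;
  by have -> : - (L - j * s%:Z) = - L + j * s%:Z by lia.
Qed.

Let right_merge_psi s L : right_merge X (iter s psi) L <->
  right_merge X (iter (i * s) phi) (L - j * s%:Z).
Proof.
have e : 1 - (L - j * s%:Z) = 1 - L + j * s%:Z by lia.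
split=> h x y Xx Xy xy pxy; apply: (h x y) => //; move: pxy; rewrite !iter_psi // e.
  by move=> pxy; apply/agreeL_shift.
by move/agreeL_shift.
Qed.

(** On [X] the power [psi^s] is [phi^(i s)] followed by the shift by [j s], so degree at least 1 for
    [psi^s] is exactly the threshold [1 - j * s] for [phi^(i s)]. *)
Lemma slope_hyperbolic (P Q : nat -> \bar R) :
  (forall s, is_degree (left_det X (iter s phi)) (P s)) ->
  (forall s, is_degree (right_merge X (iter s phi)) (Q s)) ->
  (maxe (- limn (fun s => P s * (s%:R^-1)%:E)) (- limn (fun s => Q s * (s%:R^-1)%:E))
     < (j%:~R / i%:R)%:E)%E <-> LR_hyperbolic X psi.
Proof.
move=> hP hQ; have ls s := local_endo_iter s lphi; have [mp [r lr] sp] := lphi.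
rewrite gt_max -(rwP andP).
have -> : (- limn (fun s => P s * (s%:R^-1)%:E) < (j%:~R / i%:R)%:E)%E <->
    exists2 s, (0 < s)%N & left_det X (iter (i * s) phi) (1 - j * s%:Z).
  apply: (growth_lt_slope (D := fun s => left_det X (iter s phi))) => //.
  - by move=> s L L'; exact: left_detW.
  - by move=> x y Xx Xy xy; apply: xy.
  - by move=> s t L L' h h'; rewrite iterD_comp; exact: left_det_comp.
  - move=> s L _ _; exists (- r%:Z) => x y Xx Xy xy.
    by apply: (agreeR_local lr Xx Xy xy); lia.
have -> : (- limn (fun s => Q s * (s%:R^-1)%:E) < (j%:~R / i%:R)%:E)%E <->
    exists2 s, (0 < s)%N & right_merge X (iter (i * s) phi) (1 - j * s%:Z).
  apply: (growth_lt_slope (D := fun s => right_merge X (iter s phi))) => //.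
  - by move=> s L L'; exact: right_mergeW.
  - by move=> x y Xx Xy xy; apply; lia.
  - by move=> s t L L' h h'; rewrite iterD_comp; exact: right_merge_comp.
  (* Agreement of the images under [phi] passes to [phi^(s+1)] at the cost of the radius [r'] of
     [phi^s]; a bound for the power therefore yields one for [phi]. *)
  - case=> // s L _ h; have [_ [r' lr'] _] := ls s; exists (L - r'%:Z).
    move=> x y Xx Xy xy pxy; apply: h => //; rewrite !iterSr.
    have := agreeL_local lr' (mp _ Xx) (mp _ Xy) pxy.
    by apply: agreeLW; lia.
split=> -[[s s0 hs] [t t0 ht]]; split.
- by exists s => //; apply/left_det_psi.
- by exists t => //; apply/right_merge_psi.
- by exists s => //; apply/left_det_psi.
- by exists t => //; apply/right_merge_psi.
Qed.

End Slope.

Lemma flip_mix {A : finType} (phi : biseq A -> biseq A) i j :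
  flip_map (fun x => iter i phi (shiftz j x)) =
  (fun x => iter i (flip_map phi) (shiftz (- j) x)).
Proof.
by apply/funext => x; rewrite -flip_iter /flip_map flip_shiftz opprK.
Qed.

Section Cones.
Context {R : realType} {A : finType} (X : set (biseq A)).
Hypothesis cX : shift_closed X.
Variable phi : biseq A -> biseq A.
Hypothesis lphi : local_endo X phi.
Variables (i : nat) (j : int).
Hypothesis i0 : (0 < i)%N.

Let psi (x : biseq A) := iter i phi (shiftz j x).

Lemma cR_hyperbolic :
  (cR X R phi < (j%:~R / i%:R)%:E)%E <-> LR_hyperbolic X psi.
Proof.
apply: slope_hyperbolic => // s.
  by apply: PL_degree => //; exact: local_endo_iter.
by apply: QR_degree => //; exact: local_endo_iter.
Qed.

(** Reflection turns the degrees [PR] and [QL] into those of [left_det] and [right_merge], and [j]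
    into [-j]; negating the inequality turns the minimum into the maximum of the negatives. *)
Lemma cL_hyperbolic :
  ((j%:~R / i%:R)%:E < cL X R phi)%E <-> LR_hyperbolic (flip_set X) (flip_map psi).
Proof.
rewrite /psi flip_mix /cL lt_min.
have hP s : is_degree (left_det (flip_set X) (iter s (flip_map phi)))
    (PR X R (iter s phi)).
  by rewrite -flip_iter; apply: PR_degree => //; exact: local_endo_iter.
have hQ s : is_degree (right_merge (flip_set X) (iter s (flip_map phi)))
    (QL X R (iter s phi)).
  by rewrite -flip_iter; apply: QL_degree => //; exact: local_endo_iter.
rewrite -(slope_hyperbolic (shift_closed_flip cX) (local_endo_flip lphi) (- j) i0 hP hQ).
by rewrite gt_max rmorphN /= mulNr EFinN !lteN2.
Qed.

End Cones.

(** * Conjugacies *)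

Lemma nbhs_set_type (A : finType) (X : set (biseq A)) (x : X) (U : set X) :
  nbhs x U <-> exists M : nat, forall y : X,
    agree (- M%:Z) M%:Z (set_val x) (set_val y) -> U y.
Proof.
split=> [[_ [[W oW <-] Wx sWU]]|[M hM]].
  have /nbhs_biseq[M hM] : nbhs (set_val x) W by exact: open_nbhs_nbhs.
  by exists M => y xy; apply: sWU; exact: hM.
have := cyl_nbhs (set_val x) M; rewrite nbhsE => -[W [oW Wx] WM].
exists (set_val @^-1` W); split=> //=; first by exists W.
by move=> y Wy; apply: hM; exact: WM.
Qed.

(* The graph of a conjugacy between (X, psi) and (X', psi'); a relation avoids
   having to choose values outside X. *)
Definition conjugacy {A A' : finType} (X : set (biseq A)) (X' : set (biseq A'))
    psi psi' (F : biseq A -> biseq A' -> Prop) : Prop :=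
  [/\ forall x x', F x x' -> X x /\ X' x',
      forall x, X x -> exists x', F x x',
      forall x', X' x' -> exists x, F x x',
      exists r : nat, forall x x' y y' k, F x x' -> F y y' ->
        (agree (k - r%:Z) (k + r%:Z) x y -> x' k = y' k) /\
        (agree (k - r%:Z) (k + r%:Z) x' y' -> x k = y k) &
      forall x x', F x x' -> F (psi x) (psi' x') /\
        forall j, F (shiftz j x) (shiftz j x')].

Section Conjugacy.
Context {A A' : finType} (X : set (biseq A)) (X' : set (biseq A')).
Variables (psi : biseq A -> biseq A) (psi' : biseq A' -> biseq A').
Hypotheses (cX : shift_closed X) (cX' : shift_closed X').
Hypothesis mpsi : forall x, X x -> X (psi x).

Let mk (Y : set (biseq A)) y (Yy : Y y) : Y := exist _ y (mem_set Yy).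

(** The relation is the graph of [theta]. Compactness, applied to it and to its converse, makes both
    continuity conditions uniform; the inverse shift is handled through the uniqueness of images. *)
Lemma conjugacy_of_homeomorphism (theta : X -> X') :
  homeomorphism theta -> intertwines theta Defs.shift Defs.shift ->
  intertwines theta psi psi' -> exists F, conjugacy X X' psi psi' F.
Proof.
move=> [cth [th' [cth' thK thK']]] ths thp.
pose F (x : biseq A) (x' : biseq A') :=
  exists2 y : X, set_val y = x & set_val (theta y) = x'.
have Fin x : X x -> exists x', F x x'.
  by move=> Xx; exists (set_val (theta (mk Xx))), (mk Xx).
have Fsur x' : X' x' -> exists x, F x x'.
  move=> Xx'; pose z : X' := exist _ x' (mem_set Xx').
  by exists (set_val (th' z)), (th' z) => //; rewrite thK'.
have Ffun x x' x'' : F x x' -> F x x'' -> x' = x''.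
  by move=> [y <- <-] [y' /val_inj -> <-].
have FX x x' : F x x' -> X x /\ X' x'.
  by move=> [y <- <-]; split; exact: set_valP.
have [sX _] := cX; have [sX' _] := cX'.
have F1 x x' : F x x' -> F (shiftz 1 x) (shiftz 1 x').
  move=> [y yx <-]; have Xx : X x by rewrite -yx; exact: set_valP.
  exists (mk (sX _ Xx 1)) => //; apply: ths => /=.
  by rewrite yx.
have FN1 x x' : F x x' -> F (shiftz (-1) x) (shiftz (-1) x').
  move=> Fx; have [Xx _] := FX _ _ Fx; have [z Fz] := Fin _ (sX _ Xx (-1)).
  have := F1 _ _ Fz; rewrite shiftzNK => /(Ffun _ _ _ Fx) ->.
  by rewrite shiftzK.
have Fs x x' j : F x x' -> F (shiftz j x) (shiftz j x').
  have FP n y y' : F y y' -> F (shiftz n%:Z y) (shiftz n%:Z y').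
    elim: n => [|n IH] Fy; first by rewrite !shiftz0.
    by rewrite -addn1 PoszD addrC -!(shiftzD 1); apply: F1; apply: IH.
  have FN n y y' : F y y' -> F (shiftz (- n%:Z) y) (shiftz (- n%:Z) y').
    elim: n => [|n IH] Fy; first by rewrite !shiftz0.
    by rewrite -addn1 PoszD addrC opprD -!(shiftzD (-1)); apply: FN1; apply: IH.
  have [j0|j0] := leP 0 j; first by rewrite -(gez0_abs j0); exact: FP.
  have -> : j = - (`|j|%N)%:Z by lia.
  exact: FN.
exists F; split=> //; last first.
  move=> x x' Fx; split=> [|j]; last exact: Fs.
  case: Fx => y yx yx'; have Xx : X x by rewrite -yx; exact: set_valP.
  exists (mk (mpsi Xx)) => //; rewrite -yx'; apply: thp => /=.
  by rewrite yx.
have [||||r hr] := uniformly_local (F := F) cX => //.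
- by move=> x x' /FX[].
- move=> x x' [y yx yx'].
  have /cth/nbhs_set_type[M hM] : nbhs (theta y)
      [set z : X' | agree 0 0 (set_val (theta y)) (set_val z)].
    by apply/nbhs_set_type; exists 0%N => z; apply.
  exists M => z z' [w wz wz'] xz; rewrite -yx' -wz'; apply: (hM w); last by [].
  by rewrite yx wz.
have [||||r' hr'] := uniformly_local (F := fun x' x => F x x') cX' => //.
- by move=> x x' /FX[].
- by move=> x x' j; exact: Fs.
- move=> x' x [y yx yx'].
  have /cth'/nbhs_set_type[M hM] : nbhs (th' (theta y))
      [set z : X | agree 0 0 (set_val y) (set_val z)].
    by rewrite thK; apply/nbhs_set_type; exists 0%N => z; apply.
  exists M => z' z [w wz wz'] xz; rewrite -yx -wz.
  have := hM (theta w); rewrite /= thK; apply; last by [].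
  by rewrite yx' wz'.
exists (r + r')%N => x x' y y' k Fx Fy; split=> xy.
  by apply: (hr x _ y) => // l lk; apply: xy; lia.
by apply: (hr' x' _ y') => // l lk; apply: xy; lia.
Qed.

Lemma homeomorphism_of_conjugacy F : conjugacy X X' psi psi' F ->
  exists theta : X -> X', [/\ homeomorphism theta,
    intertwines theta Defs.shift Defs.shift & intertwines theta psi psi'].
Proof.
move=> [FX Fin Fsur [r hr] Fpsi].
have Ffun x x' x'' : F x x' -> F x x'' -> x' = x''.
  move=> Fx Fx'; apply/funext => k; have [h _] := hr _ _ _ _ k Fx Fx'.
  exact: h.
have Finj x y x' : F x x' -> F y x' -> x = y.
  move=> Fx Fy; apply/funext => k; have [_ h] := hr _ _ _ _ k Fx Fy.
  exact: h.
have /choice[th hth] : forall x : X, exists x' : X', F (set_val x) (set_val x').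
  move=> x; have [x' Fx] := Fin _ (set_valP x); have [_ Xx'] := FX _ _ Fx.
  by exists (exist _ x' (mem_set Xx')).
have /choice[th' hth'] : forall x' : X', exists x : X, F (set_val x) (set_val x').
  move=> x'; have [x Fx] := Fsur _ (set_valP x'); have [Xx _] := FX _ _ Fx.
  by exists (mk Xx).
exists th; split.
- split.
    move=> x U /nbhs_set_type[M hM]; apply/nbhs_set_type; exists (M + r)%N => y xy.
    apply: hM => k kM; have [h _] := hr _ _ _ _ k (hth x) (hth y).
    by apply: h => l lk; apply: xy; lia.
  exists th'; split.
  + move=> x U /nbhs_set_type[M hM]; apply/nbhs_set_type; exists (M + r)%N => y xy.
    apply: hM => k kM; have [_ h] := hr _ _ _ _ k (hth' x) (hth' y).
    by apply: h => l lk; apply: xy; lia.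
  + by move=> x; apply/val_inj/(Finj _ _ _ (hth' (th x)))/hth.
  + by move=> x; apply/val_inj/(Ffun _ _ _ (hth (th' x)))/hth'.
- move=> x y yx; apply: (Ffun (set_val y)); first exact: hth.
  by rewrite yx; have [_ h] := Fpsi _ _ (hth x); exact: h.
- move=> x y yx; apply: (Ffun (set_val y)); first exact: hth.
  by rewrite yx; have [h _] := Fpsi _ _ (hth x).
Qed.

End Conjugacy.

Lemma conjugacy_flip {A A' : finType} (X : set (biseq A)) (X' : set (biseq A'))
    psi psi' F : conjugacy X X' psi psi' F ->
  conjugacy (flip_set X) (flip_set X') (flip_map psi) (flip_map psi')
    (fun x x' => F (flip x) (flip x')).
Proof.
move=> [FX Fin Fsur [r hr] Fpsi]; split.
- by move=> x x' /FX.
- by move=> x /Fin[x' Fx]; exists (flip x'); rewrite flipK.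
- by move=> x' /Fsur[x Fx]; exists (flip x); rewrite flipK.
- exists r => x x' y y' k Fx Fy; have [h1 h2] := hr _ _ _ _ (- k) Fx Fy.
  split=> xy.
    move: h1; rewrite /flip opprK; apply; apply/agree_flip => l lk; apply: xy; lia.
  move: h2; rewrite /flip opprK; apply; apply/agree_flip => l lk; apply: xy; lia.
- move=> x x' Fx; have [h1 h2] := Fpsi _ _ Fx; split; first by rewrite /flip_map !flipK.
  by move=> j; rewrite !flip_shiftz; apply: h2.
Qed.

(** Pairs separated at column 0 whose images agree on growing windows accumulate at two points with
    the same image. By injectivity these are one point, which contradicts the separation. *)
Lemma injective_local {A A' : finType} (X : set (biseq A))
    (f : biseq A -> biseq A') s :
  shift_closed X -> local_map X f s ->
  (forall x, X x -> forall j, f (shiftz j x) = shiftz j (f x)) ->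
  set_inj X f ->
  exists r : nat, forall x y k, X x -> X y ->
    agree (k - r%:Z) (k + r%:Z) (f x) (f y) -> x k = y k.
Proof.
move=> cX lf sf fI; have [sX _] := cX; apply: contrapT => /forallNP nr.
have {}nr (r : nat) : exists xy : biseq A * biseq A,
    [/\ X xy.1, X xy.2, agree (- r%:Z) r%:Z (f xy.1) (f xy.2) & xy.1 0 <> xy.2 0].
  apply: contrapT => /forallNP h; apply: (nr r) => x y k Xx Xy xy.
  apply: contrapT => ne; apply: (h (shiftz k x, shiftz k y)).
  split; [exact: sX|exact: sX| |by rewrite /shiftz /= add0r].
  by rewrite /= !sf //; apply/agree_shift => l lk; apply: xy; lia.
have [u Hu] := choice nr.
have [x [y [Xx Xy H]]] := cluster_pair (u := fun n => (u n).1) (v := fun n => (u n).2)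
  cX cX (fun n => let: And4 a _ _ _ := Hu n in a)
  (fun n => let: And4 _ a _ _ := Hu n in a).
have xy : x = y.
  apply: fI; [exact/mem_set|exact/mem_set|apply/funext => k].
  have [n [nk xn yn]] := H (`|k| + s)%N `|k|%N; have [X1 X2 e _] := Hu n.
  have -> : f x k = f (u n).1 k by apply: lf => // l lk; apply: xn; lia.
  have -> : f y k = f (u n).2 k by apply: lf => // l lk; apply: yn; lia.
  by apply: e; lia.
have [n [_ xn yn]] := H 0%N 0%N; have [_ _ _ ne] := Hu n; apply: ne.
by rewrite -xn // -yn // xy.
Qed.

(** * Degrees of weakly LR maps *)

Section WeaklyLR.
Context {B A : finType} (Gam : graph B) (G : graph A) (p q : graph_hom Gam G).
Variables (Z : set (biseq B)) (X : set (biseq A)) (psi : biseq A -> biseq A).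
Hypotheses (cZ : shift_closed Z) (Zpaths : Z `<=` paths Gam).
Hypothesis pZ : set_bij Z X (Defs.induced p).
Hypothesis psiE : forall z, Z z -> psi (Defs.induced p z) = Defs.induced q z.
Hypothesis pL : weakly_left_resolving p.
Hypothesis qR : weakly_right_resolving q.

Let p_local : exists r : nat, forall z w k, Z z -> Z w ->
  agree (k - r%:Z) (k + r%:Z) (Defs.induced p z) (Defs.induced p w) -> z k = w k.
Proof.
have [_ pI _] := pZ; apply: (injective_local (s := 0%N)) => //.
by move=> z w _ _ k zw; rewrite /Defs.induced zw //; lia.
Qed.

(** The local inverse of [p] gives equal arcs from column [r] on. Then equality descends one column
    at a time: the next arcs give equal terminal vertices, and the labels under [p] agree down to
    column 0. *)
Lemma weakly_LR_left_det : left_det X psi 0.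
Proof.
have [r hr] := p_local; have [_ _ pS] := pZ.
move=> x y /pS[z Zz <-] /pS[w Zw <-] zw; rewrite !psiE // /Defs.induced.
have hi k : r%:Z <= k -> z k = w k.
  by move=> kr; apply: hr => // l lk; apply: zw; lia.
suff lo n k : r%:Z - n%:Z <= k -> 0 <= k -> z k = w k by rewrite (lo r 0) ?oppr0 //; lia.
elim: n k => [|n IH] k kr k0; first by apply: hi; lia.
apply: pL; last exact: (zw k k0).
by rewrite (Zpaths Zz k) (Zpaths Zw k) IH //; lia.
Qed.

(** The local inverse of [p] gives equal arcs up to column [-r]; the images, that is the labels
    under [q], agree up to column 1 and carry equality there by weak right resolvingness. *)
Lemma weakly_LR_right_merge : right_merge X psi 0.
Proof.
have [r hr] := p_local; have [_ _ pS] := pZ.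
move=> x y /pS[z Zz <-] /pS[w Zw <-] zw; rewrite !psiE // /Defs.induced subr0 => qzw.
congr (harc p _).
suff hi n k : k <= n%:Z - r%:Z -> k <= 1 -> z k = w k by apply: (hi r.+1); lia.
elim: n k => [|n IH] k kr k1.
  by apply: hr => // l lk; apply: zw; lia.
apply: qR; last exact: qzw.
have := Zpaths Zz (k - 1); rewrite subrK => <-.
have := Zpaths Zw (k - 1); rewrite subrK => <-.
by rewrite IH //; lia.
Qed.

End WeaklyLR.

(** Degrees at least 0 persist for all powers of [psi']. Coding and decoding cost [r] columns each,
    so the loss is [r + r] for every power of [psi]. *)
Lemma conjugacy_LR_hyperbolic {A A' : finType} (X : set (biseq A))
    (X' : set (biseq A')) psi psi' F (M : nat) :
  shift_closed X -> shift_closed X' -> local_endo X psi -> local_endo X' psi' ->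
  set_surj X X psi -> expansive_width X psi M -> conjugacy X X' psi psi' F ->
  left_det X' psi' 0 -> right_merge X' psi' 0 -> LR_hyperbolic X psi.
Proof.
move=> cX cX' lp lp' sp eM [FX Fin _ [r hr] Fpsi] dL mR.
have Fs s x x' : F x x' -> F (iter s psi x) (iter s psi' x').
  by move=> Fx; elim: s => // s IH; rewrite !iterS; case: (Fpsi _ _ IH).
have ls s := local_endo_iter s lp'.
apply: (LR_hyperbolic_of_bounds (C := (r + r)%N) cX lp sp eM).
  move=> s x y /Fin[x' Fx] /Fin[y' Fy] xy k kr.
  have [_ Xx'] := FX _ _ Fx; have [_ Xy'] := FX _ _ Fy.
  have [_ h] := hr _ _ _ _ k (Fs s _ _ Fx) (Fs s _ _ Fy); apply: h => l lk.
  have xy' : agreeR r%:Z x' y'.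
    move=> i ir; have [h _] := hr _ _ _ _ i Fx Fy; apply: h => o oi; apply: xy; lia.
  have := left_detP cX' (ls s) (left_det_iter cX' s lp' dL) Xx' Xy' xy'.
  by rewrite mulr0 subr0; apply; lia.
move=> s t x y /Fin[x' Fx] /Fin[y' Fy] xy sxy k kr.
have [_ Xx'] := FX _ _ Fx; have [_ Xy'] := FX _ _ Fy.
have [_ h] := hr _ _ _ _ k Fx Fy; apply: h => l lk.
have xy' : agreeL (t - r%:Z) x' y'.
  move=> i ir; have [h _] := hr _ _ _ _ i Fx Fy; apply: h => o oi; apply: xy; lia.
have sxy' : agreeL (- r%:Z) (iter s psi' x') (iter s psi' y').
  move=> i ir; have [h _] := hr _ _ _ _ i (Fs s _ _ Fx) (Fs s _ _ Fy).
  by apply: h => o oi; apply: sxy; lia.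
have := right_mergeP cX' (ls s) (right_merge_iter (n := s) cX' lp' mR) Xx' Xy' xy' sxy'.
by rewrite mulr0 addr0; apply; lia.
Qed.

Section Base.
Context {B A : finType} (Gam : graph B) (G : graph A) (p q : graph_hom Gam G).

Lemma shift_closed_paths : shift_closed (paths Gam).
Proof.
split=> [x px j k|x h k]; first by rewrite /shiftz px; congr ini; congr x; lia.
have [y py xy] := h (`|k| + 1)%N; rewrite !xy; [exact: py|lia|lia].
Qed.

(** The witnessing arrays of paths converge along a common extraction over rows and columns. With
    this, [textile_base] can play the role of [Z] in the estimates for weakly LR maps. *)
Lemma shift_closed_textile_base : shift_closed (textile_base p q).
Proof.
have [sP cP] := shift_closed_paths; split.
  move=> z [zs [pz z0 qp]] j; exists (fun i => shiftz j (zs i)); split.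
  - by move=> i; exact: sP.
  - by rewrite z0.
  - move=> i; apply/funext => k; have := congr1 (fun w : biseq A => w (k + j)) (qp i).
    by [].
move=> z h; have [u Hu] := choice (fun n : nat =>
  let: ex_intro2 y ty zy := h n in
  let: ex_intro zs (And3 a b c) := ty in
  ex_intro (fun zs : int -> biseq B => [/\ forall i, paths Gam (zs i),
    agree (- n%:Z) n%:Z z (zs 0) &
    forall i, Defs.induced q (zs (i - 1)) = Defs.induced p (zs i)]) zs
    (And3 a (eq_ind_r (agree (- n%:Z) n%:Z z) zy b) c)).
have [v hv] := cluster_seq (fun n (ik : int * int) => u n ik.1 ik.2).
have H (I K N : nat) : exists2 n, (N <= n)%N &
    forall i, - I%:Z <= i <= I%:Z -> agree (- K%:Z) K%:Z (fun k => v (i, k)) (u n i).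
  have [n Nn e] := hv [seq (i, k) | i <- window I, k <- window K] N; exists n => //.
  by move=> i iI k kK; rewrite -e //; apply: allpairs_f; exact: mem_window.
exists (fun i k => v (i, k)); split.
- move=> i; apply: cP => K; have [n _ hn] := H `|i|%N K 0%N; exists (u n i).
    by have [pu _ _] := Hu n.
  by apply: hn; lia.
- apply/funext => k; have [n kn hn] := H 0%N `|k|%N `|k|%N; have [_ zu _] := Hu n.
  by rewrite hn ?zu //; lia.
- move=> i; apply/funext => k; have [n _ hn] := H (`|i| + 1)%N `|k|%N 0%N.
  have [_ _ qp] := Hu n; rewrite /Defs.induced hn; [|lia|lia].
  rewrite (hn i); [|lia|lia]; exact: (congr1 (fun w : biseq A => w k) (qp i)).
Qed.

End Base.

(** * The textile system of rectangular patterns *)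

Section ConjugacyTransfer.
Context {A A' : finType} (X : set (biseq A)) (X' : set (biseq A')).
Variables (psi : biseq A -> biseq A) (psi' : biseq A' -> biseq A').
Variable F : biseq A -> biseq A' -> Prop.
Hypothesis cF : conjugacy X X' psi psi' F.

Lemma conjugacy_fun x x' x'' : F x x' -> F x x'' -> x' = x''.
Proof.
have [_ _ _ [r hr] _] := cF; move=> Fx Fx'; apply/funext => k.
by have [h _] := hr _ _ _ _ k Fx Fx'; exact: h.
Qed.

Lemma conjugacy_shift_closed : shift_closed X -> shift_closed X'.
Proof.
have [FX Fin Fsur [r hr] Fpsi] := cF; move=> cX; split.
  move=> x' /Fsur[x Fx] j; have [_ /(_ j) h] := Fpsi _ _ Fx.
  by have [_] := FX _ _ h.
move=> y hy.
have /choice[u Hu] : forall n : nat, exists u : biseq A * biseq A',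
    F u.1 u.2 /\ agree (- n%:Z) n%:Z y u.2.
  by move=> n; have [y' /Fsur[x Fx] yy'] := hy n; exists (x, y').
have [x Xx hx] := cluster_point (u := fun n => (u n).1) cX
  (fun n => (FX _ _ (Hu n).1).1).
have [x' Fx] := Fin _ Xx; suff -> : y = x' by have [_] := FX _ _ Fx.
apply/funext => k; have [n kn xn] := hx (`|k| + r)%N `|k|%N.
have [Fu yu] := Hu n; rewrite yu; last lia.
have [h _] := hr _ _ _ _ k Fx Fu; symmetry; apply: h => l lk; apply: xn; lia.
Qed.

Lemma conjugacy_local_endo : local_endo X psi -> local_endo X' psi'.
Proof.
have [FX Fin Fsur [r hr] Fpsi] := cF; move=> [mp [s lp] sp]; split.
- by move=> x' /Fsur[x Fx]; have [/FX[]] := Fpsi _ _ Fx.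
- exists (r + s + r)%N => x' y' /Fsur[x Fx] /Fsur[y Fy] k xy'.
  have [Fpx _] := Fpsi _ _ Fx; have [Fpy _] := Fpsi _ _ Fy.
  have [h _] := hr _ _ _ _ k Fpx Fpy; apply: h => l lk.
  apply: lp; [by have [] := FX _ _ Fx|by have [] := FX _ _ Fy|] => i il.
  have [_ h] := hr _ _ _ _ i Fx Fy; apply: h => o oi; apply: xy'; lia.
- move=> x' /Fsur[x Fx] j; have [Fpx Fsx] := Fpsi _ _ Fx.
  have [_ Fspx] := Fpsi _ _ Fpx; have [Xx _] := FX _ _ Fx.
  apply: conjugacy_fun (Fspx j); rewrite -sp //.
  by have [] := Fpsi _ _ (Fsx j).
Qed.

Lemma conjugacy_surj : set_surj X X psi -> set_surj X' X' psi'.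
Proof.
have [FX Fin Fsur _ Fpsi] := cF; move=> sp x' /Fsur[x Fx].
have [Xx _] := FX _ _ Fx; have [y Xy yx] := sp _ Xx.
have [y' Fy] := Fin _ Xy; exists y'; first by have [] := FX _ _ Fy.
by have [Fpy _] := Fpsi _ _ Fy; rewrite /= yx in Fpy; exact: conjugacy_fun Fpy Fx.
Qed.

End ConjugacyTransfer.

Section Patterns.
Context {A : finType} (X : set (biseq A)) (psi : biseq A -> biseq A).
Hypotheses (cX : shift_closed X) (lp : local_endo X psi).

(* The rectangular pattern with rows x, psi x, ..., psi^(r-1) x restricted to
   the columns 0, ..., w-1. *)
Definition pattern r w (x : biseq A) : {ffun 'I_r * 'I_w -> A} :=
  [ffun ik : 'I_r * 'I_w => iter ik.1 psi x (nat_of_ord ik.2)%:Z].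

Definition occurs r w (t : {ffun 'I_r * 'I_w -> A}) : Prop :=
  exists2 x, X x & t = pattern r w x.

(* The flag b = true, allowing all patterns, only serves to give the alphabet of
   the recoded subshift at least two letters when X has a single point. *)
Definition pat (b : bool) r w : finType :=
  {t : {ffun 'I_r * 'I_w -> A} | b || `[< occurs t >]}.

Lemma pat_occurs r w (t : pat false r w) :
  exists2 x, X x & val t = pattern r w x.
Proof. by have /= /asboolP := valP t. Qed.

Lemma patternP r w x y : pattern r w x = pattern r w y <->
  forall i, (i < r)%N -> agree 0 (w%:Z - 1) (iter i psi x) (iter i psi y).
Proof.
split=> [/ffunP e i ir k kw|e].
  have kw' : (`|k| < w)%N by lia.
  have := e (Ordinal ir, Ordinal kw'); rewrite !ffunE /=.
  by have -> : (`|k|%N)%:Z = k by lia.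
apply/ffunP => -[i k]; rewrite !ffunE /=; apply: e => //.
by have := ltn_ord k; lia.
Qed.

Definition left_cols r w (t : {ffun 'I_r * 'I_w.+1 -> A}) :
  {ffun 'I_r * 'I_w -> A} := [ffun ik : 'I_r * 'I_w => t (ik.1, widen_ord (leqnSn w) ik.2)].

Definition right_cols r w (t : {ffun 'I_r * 'I_w.+1 -> A}) :
  {ffun 'I_r * 'I_w -> A} := [ffun ik : 'I_r * 'I_w => t (ik.1, lift ord0 ik.2)].

Definition top_rows r w (t : {ffun 'I_r.+1 * 'I_w -> A}) :
  {ffun 'I_r * 'I_w -> A} := [ffun ik : 'I_r * 'I_w => t (widen_ord (leqnSn r) ik.1, ik.2)].

Definition bottom_rows r w (t : {ffun 'I_r.+1 * 'I_w -> A}) :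
  {ffun 'I_r * 'I_w -> A} := [ffun ik : 'I_r * 'I_w => t (lift ord0 ik.1, ik.2)].

Lemma left_cols_pattern r w x : left_cols (pattern r w.+1 x) = pattern r w x.
Proof. by apply/ffunP => ik; rewrite !ffunE. Qed.

Lemma right_cols_pattern r w x : X x ->
  right_cols (pattern r w.+1 x) = pattern r w (shiftz 1 x).
Proof.
move=> Xx; apply/ffunP => -[i k]; rewrite !ffunE /=.
have [_ _ ->] := local_endo_iter i lp; last by [].
by rewrite /shiftz -PoszD addn1.
Qed.

Lemma top_rows_pattern r w x : top_rows (pattern r.+1 w x) = pattern r w x.
Proof. by apply/ffunP => ik; rewrite !ffunE. Qed.

Lemma bottom_rows_pattern r w x :
  bottom_rows (pattern r.+1 w x) = pattern r w (psi x).
Proof. by apply/ffunP => -[i k]; rewrite !ffunE /= -iterSr. Qed.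

Section Restrict.
Variables (b b' : bool) (bb' : b ==> b') (r w r' w' : nat).
Variable f : {ffun 'I_r * 'I_w -> A} -> {ffun 'I_r' * 'I_w' -> A}.
Hypothesis f_occurs : forall t, occurs t -> occurs (f t).

Lemma restrict_subproof (t : pat b r w) : b' || `[< occurs (f (val t)) >].
Proof.
apply/orP; have /orP[bt|/asboolP/f_occurs ot] := valP t.
  by left; apply: (implyP bb').
by right; apply/asboolP.
Qed.

Definition restrict (t : pat b r w) : pat b' r' w' :=
  exist _ (f (val t)) (restrict_subproof t).

End Restrict.

Lemma left_cols_occurs r w (t : {ffun 'I_r * 'I_w.+1 -> A}) :
  occurs t -> occurs (left_cols t).
Proof. by move=> [x Xx ->]; exists x; rewrite ?left_cols_pattern. Qed.

Lemma right_cols_occurs r w (t : {ffun 'I_r * 'I_w.+1 -> A}) :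
  occurs t -> occurs (right_cols t).
Proof.
move=> [x Xx ->]; exists (shiftz 1 x); last by rewrite right_cols_pattern.
by have [sX _] := cX; exact: sX.
Qed.

Lemma top_rows_occurs r w (t : {ffun 'I_r.+1 * 'I_w -> A}) :
  occurs t -> occurs (top_rows t).
Proof. by move=> [x Xx ->]; exists x; rewrite ?top_rows_pattern. Qed.

Lemma bottom_rows_occurs r w (t : {ffun 'I_r.+1 * 'I_w -> A}) :
  occurs t -> occurs (bottom_rows t).
Proof.
move=> [x Xx ->]; exists (psi x); last by rewrite bottom_rows_pattern.
by have [mp _ _] := lp; exact: mp.
Qed.

Definition pattern_graph (b : bool) r w : graph (pat b r w.+1) :=
  @Graph (pat b r w.+1) (pat b r w)
    (restrict (implybb b) (@left_cols_occurs r w))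
    (restrict (implybb b) (@right_cols_occurs r w)).

Definition top_hom b r w :
  graph_hom (pattern_graph false r.+1 w) (pattern_graph b r w).
Proof.
exists (restrict (isT : false ==> b) (@top_rows_occurs r w.+1))
  (restrict (isT : false ==> b) (@top_rows_occurs r w)) => t;
by apply/val_inj/ffunP => ik; rewrite !ffunE.
Defined.

Definition bottom_hom b r w :
  graph_hom (pattern_graph false r.+1 w) (pattern_graph b r w).
Proof.
exists (restrict (isT : false ==> b) (@bottom_rows_occurs r w.+1))
  (restrict (isT : false ==> b) (@bottom_rows_occurs r w)) => t;
by apply/val_inj/ffunP => ik; rewrite !ffunE.
Defined.

Definition coded b r w (x : biseq A) (y : biseq (pat b r w.+1)) : Prop :=
  X x /\ forall j, val (y j) = pattern r w.+1 (shiftz j x).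

Definition code_set b r w : set (biseq (pat b r w.+1)) :=
  [set y | exists x, coded x y].

Definition decode b r w (y : biseq (pat b r.+1 w.+1)) : biseq A :=
  fun k => val (y k) (ord0, ord0).

(** The point is read off in the corners of the symbols, moved by [psi] and coded again. Off
    [code_set] the result may be inadmissible, and [insubd] then keeps the old symbol. *)
Definition code_map b r w (y : biseq (pat b r.+1 w.+1)) :
    biseq (pat b r.+1 w.+1) :=
  fun j => insubd (y j) (pattern r.+1 w.+1 (shiftz j (psi (decode y)))).

Lemma coded_exists b r w x : X x -> exists y : biseq (pat b r w.+1), coded x y.
Proof.
move=> Xx; have [sX _] := cX.
have h j : b || `[< occurs (pattern r w.+1 (shiftz j x)) >].
  by apply/orP; right; apply/asboolP; exists (shiftz j x) => //; exact: sX.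
by exists (fun j => exist _ (pattern r w.+1 (shiftz j x)) (h j) : pat b r w.+1).
Qed.

Lemma coded_decode b r w x (y : biseq (pat b r.+1 w.+1)) :
  coded x y -> decode y = x.
Proof.
by move=> [Xx e]; apply/funext => k; rewrite /decode e ffunE /= /shiftz add0r.
Qed.

Lemma coded_fun b r w x (y z : biseq (pat b r w.+1)) :
  coded x y -> coded x z -> y = z.
Proof. by move=> [_ ey] [_ ez]; apply/funext => j; apply: val_inj; rewrite ey ez. Qed.

Lemma coded_top b r w x (z : biseq (pat false r.+1 w.+1)) :
  coded x z -> coded x (Defs.induced (top_hom b r w) z).
Proof.
by move=> [Xx ez]; split=> // j; rewrite /= ez top_rows_pattern.
Qed.

Lemma coded_bottom b r w x (z : biseq (pat false r.+1 w.+1)) :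
  coded x z -> coded (psi x) (Defs.induced (bottom_hom b r w) z).
Proof.
have [mp _ sp] := lp; move=> [Xx ez]; split=> [|j]; first exact: mp.
by rewrite /= ez bottom_rows_pattern sp.
Qed.

Lemma local_map_iters n :
  exists s : nat, forall i, (i < n)%N -> local_map X (iter i psi) s.
Proof.
elim: n => [|n [s hs]]; first by exists 0%N.
have [_ [t ht] _] := local_endo_iter n lp; exists (s + t)%N => i.
rewrite ltnS leq_eqVlt => /predU1P[->|i_n]; first by apply: local_mapW ht; lia.
by apply: local_mapW (hs i i_n); lia.
Qed.

Lemma conjugacy_code b r w :
  conjugacy X (@code_set b r.+1 w) psi (@code_map b r w) (@coded b r.+1 w).
Proof.
have [mp _ sp] := lp; have [sX _] := cX; split.
- by move=> x y cxy; split; [case: cxy|exists x].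
- by move=> x; exact: coded_exists.
- by move=> y [x cxy]; exists x.
- have [s hs] := local_map_iters r.+1.
  exists (s + w)%N => x y x' y' k cx cx'; split=> xx.
    have [Xx ey] := cx; have [Xx' ey'] := cx'.
    apply: val_inj; rewrite ey ey'; apply/patternP => i ir l lw.
    apply: (hs i ir); [exact: sX|exact: sX|].
    by apply/agree_shift => o ol; apply: xx; lia.
  by rewrite -(coded_decode cx) -(coded_decode cx') /decode xx //; lia.
- move=> x y cx; have [Xx ey] := cx; split.
    split=> [|j]; first exact: mp.
    rewrite /code_map (coded_decode cx) insubdK //.
    apply/orP; right; apply/asboolP; exists (shiftz j (psi x)) => //.
    by apply: sX; exact: mp.
  move=> j; split=> [|l]; first exact: sX.
  by have -> : shiftz j y l = y (l + j) by []; rewrite ey shiftzD.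
Qed.

(** The codes with [r + 2] and with [r + 1] rows stand for the same point of [X], visible in the
    corners, so deleting the last row loses nothing. *)
Lemma code_top_bij b r w :
  set_bij (@code_set false r.+2 w) (@code_set b r.+1 w) (Defs.induced (top_hom b r.+1 w)).
Proof.
split.
- by move=> z [x cx]; exists x; exact: coded_top.
- move=> z z' /set_mem[x cx] /set_mem[x' cx'] e.
  have ex := coded_decode (coded_top b cx).
  have ex' := coded_decode (coded_top b cx').
  by rewrite e ex' in ex; rewrite ex in cx'; exact: coded_fun cx cx'.
- move=> y [x cx]; have [Xx _] := cx.
  have [z cz] := coded_exists false r.+2 w Xx; exists z; first by exists x.
  exact: coded_fun (coded_top b cz) cx.
Qed.

Lemma code_map_induced b r w z : @code_set false r.+2 w z ->
  code_map (Defs.induced (top_hom b r.+1 w) z) = Defs.induced (bottom_hom b r.+1 w) z.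
Proof.
move=> [x cx]; have [_ _ _ _ h] := conjugacy_code b r w.
have [h1 _] := h _ _ (coded_top b cx).
exact: coded_fun h1 (coded_bottom b cx).
Qed.

Lemma code_set_paths b r w : @code_set b r w `<=` paths (pattern_graph b r w).
Proof.
move=> y [x [Xx ey]] j; apply: val_inj; have [sX _] := cX.
rewrite /= !ey right_cols_pattern ?left_cols_pattern ?shiftzD 1?addrC //.
exact: sX.
Qed.

Lemma top_weakly_left_resolving b r w (R : nat) :
  (forall x y, X x -> X y -> agree 0 R%:Z x y ->
    iter r.+1 psi x (-1) = iter r.+1 psi y (-1)) -> (R < w)%N ->
  weakly_left_resolving (top_hom b r.+1 w).
Proof.
move=> hR Rw al be /(congr1 val) /= tab /(congr1 val) /= pab.
have [sX _] := cX; have [x Xx ex] := pat_occurs al; have [y Xy ey] := pat_occurs be.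
apply: val_inj; rewrite [LHS]ex [RHS]ey; move: tab pab; rewrite !ex !ey.
rewrite !right_cols_pattern // !top_rows_pattern => /patternP tab /patternP pab.
have tab' i k : (i < r.+2)%N -> 1 <= k <= w%:Z -> iter i psi x k = iter i psi y k.
  move=> ir kw; have := tab i ir (k - 1); have [_ _ si] := local_endo_iter i lp.
  by rewrite !si // /shiftz subrK; apply; lia.
apply/patternP => i; rewrite ltnS leq_eqVlt => /predU1P[->|ir]; last exact: pab.
(* The terminal vertex settles the other columns of the last row; its entry in column 0 is
   determined by row 0 on the columns 1, ..., R + 1. *)
move=> k kw; have [k0|k1] := eqVneq k 0; last by apply: tab' => //; lia.
have := hR _ _ (sX _ Xx 1) (sX _ Xy 1).
have [_ _ si] := local_endo_iter r.+1 lp; rewrite !si // /shiftz k0; apply.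
by apply/agree_shift => l lR; apply: (tab' 0%N) => //; lia.
Qed.

Lemma bottom_weakly_right_resolving b r w (D : nat) :
  (forall x y, X x -> X y -> agree (- D%:Z) 0 x y ->
    agree (- D%:Z) 0 (iter r psi x) (iter r psi y) -> x 1 = y 1) -> (D < w)%N ->
  weakly_right_resolving (bottom_hom b r w).
Proof.
move=> hD Dw al be /(congr1 val) /= tab /(congr1 val) /= pab.
have [sX _] := cX; have [x Xx ex] := pat_occurs al; have [y Xy ey] := pat_occurs be.
apply: val_inj; rewrite [LHS]ex [RHS]ey; move: tab pab; rewrite !ex !ey.
rewrite !left_cols_pattern // !bottom_rows_pattern => /patternP tab /patternP pab.
apply/patternP => -[_|i ir]; last by move=> k kw; rewrite !iterSr; apply: pab.
(* The lower rows survive the deletion and the initial vertex holds row 0 up to column [w - 1], so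
   only column [w] of row 0 is open. *)
move=> k kw; have [kw'|kw'] := leP k (w%:Z - 1).
  by apply: (tab 0%N) => //; lia.
have -> : k = 1 + (w%:Z - 1) by lia.
have := hD _ _ (sX _ Xx (w%:Z - 1)) (sX _ Xy (w%:Z - 1)).
have [_ _ si] := local_endo_iter r lp; rewrite !si //; apply.
  by apply/agree_shift => l lR; apply: (tab 0%N) => //; lia.
by apply/agree_shift => l lR; apply: (tab r) => //; lia.
Qed.

Lemma weakly_LR_code (C : (1 < #|A|)%N) : LR_hyperbolic X psi ->
  exists r w, subshift (@code_set true r.+1 w) /\
    weakly_resolving LR (@code_set true r.+1 w) (@code_map true r w).
Proof.
move=> /(LR_hyperbolic_common cX lp)[[|r] [// _ dL mR]].
have lS := local_endo_iter r.+1 lp.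
have [R hR] := left_det_window cX lS dL.
have [D hD] := right_merge_window cX lS mR.
pose w := (R + D).+1; exists r, w.
have cc := conjugacy_code true r w.
have cX' := conjugacy_shift_closed cc cX.
have lp' := conjugacy_local_endo cc lp.
have cZ := conjugacy_shift_closed (conjugacy_code false r.+1 w) cX.
have [clX' sX'] := closed_of_shift_closed cX'.
split.
  split=> //; have [a [a' [_ _ aa']]] := card_gt1P C.
  apply/card_gt1P; pose cst (c : A) : pat true r.+1 w.+1 := exist _ [ffun=> c] isT.
  exists (cst a), (cst a'); split=> //; apply/negP => /eqP/(congr1 val)/ffunP.
  by move=> /(_ (ord0, ord0)); rewrite !ffunE; apply/eqP.
split; first exact: local_endomorphism.
exists (pat false r.+2 w.+1), (pattern_graph false r.+2 w),
  (pattern_graph true r.+1 w), (top_hom true r.+1 w), (bottom_hom true r.+1 w),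
  (@code_set false r.+2 w); split.
- split.
    by apply: top_weakly_left_resolving hR _; rewrite /w; lia.
  by apply: bottom_weakly_right_resolving hD _; rewrite /w; lia.
- by have [h1 h2] := closed_of_shift_closed cZ; split=> //; exact: code_set_paths.
- exact: code_top_bij.
- by move=> _ [z [x cx] <-]; exists (psi x); exact: coded_bottom.
- by move=> z; exact: code_map_induced.
Qed.

End Patterns.

(** * Resolving textile systems over subshifts of finite type *)

Section Synchronization.
Context {B A : finType} (Gam : graph B) (G : graph A) (q : graph_hom Gam G).

(** The subset construction of automata theory: [reach s] below collects the end vertices of the
    paths with label [s]. *)
Definition step (E : {set vert Gam}) (a : A) : {set vert Gam} :=
  [set ter Gam al | al in [set al | (ini Gam al \in E) && (harc q al == a)]]%SET.

Definition reach (s : seq A) : {set vert Gam} := foldl step [set: vert Gam]%SET s.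

Lemma reach_rcons s a : reach (rcons s a) = step (reach s) a.
Proof. by rewrite /reach -cats1 foldl_cat. Qed.

Hypothesis qR : weakly_right_resolving q.

(** Weak right resolvingness makes the initial vertex injective on the arcs labelled [a], and these
    arcs leave from vertices of [E] other than [u]. *)
Lemma card_step (E : {set vert Gam}) a u : u \in E -> ~ (exists al, harc q al = a /\ ini Gam al = u) ->
  (#|step E a| < #|E|)%N.
Proof.
move=> uE nal; rewrite (cardsD1 u E) uE add1n ltnS.
apply: leq_trans (leq_imset_card _ _) _.
rewrite -(card_in_imset (f := ini Gam)).
  apply: subset_leq_card; apply/fintype.subsetP => _ /imsetP[al + ->].
  rewrite !inE => /andP[-> /eqP pal]; rewrite andbT; apply/negP => /eqP iu.
  by apply: nal; exists al.
move=> al be; rewrite !inE => /andP[_ /eqP al_a] /andP[_ /eqP be_a] e.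
by apply: qR; rewrite ?al_a.
Qed.

Lemma card_step_le (E : {set vert Gam}) a : (#|step E a| <= #|E|)%N.
Proof.
apply: leq_trans (leq_imset_card _ _) _.
rewrite -(card_in_imset (f := ini Gam)).
  by apply: subset_leq_card; apply/fintype.subsetP => _ /imsetP[al + ->]; rewrite inE => /andP[].
move=> al be; rewrite !inE => /andP[_ /eqP al_a] /andP[_ /eqP be_a] e.
by apply: qR; rewrite ?al_a.
Qed.

Lemma card_foldl_step (E : {set vert Gam}) s : (#|foldl step E s| <= #|E|)%N.
Proof.
by elim: s E => //= a s IH E; apply: leq_trans (IH _) (card_step_le _ _).
Qed.

(* Choose a label s for which the set of end vertices of the paths with label s
   is nonempty and of least size.  A vertex of this set without an outgoing arc
   over some a would make the set for s a smaller; by strong connectivity every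
   vertex belongs to such a least set. *)
Lemma right_resolving_of_lifts :
  (forall v u, exists s, forall E : {set vert Gam}, v \in E -> u \in foldl step E s) ->
  (forall s u a, u \in reach s -> ini G a = hvert q u ->
     exists v, v \in reach (rcons s a)) ->
  right_resolving q.
Proof.
move=> conn lift u a ua.
suff [al [al_a al_u]] : exists al, harc q al = a /\ ini Gam al = u.
  exists al; split=> // be [be_a be_u]; apply: qR; first by rewrite al_u.
  by rewrite al_a.
apply: contrapT => nal.
have ex : exists n, `[< exists s v, v \in reach s /\ #|reach s| = n >].
  by exists #|reach [::]|; apply/asboolP; exists [::], u; split=> //; rewrite inE.
case: (ex_minnP ex) => n /asboolP[s [v [vs <-]]] min_s.
have [t ht] := conn v u; have ut := ht _ vs.
have ust : u \in reach (s ++ t) by rewrite /reach foldl_cat.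
have [v' hv'] := lift _ _ _ ust ua.
have := min_s _ (asboolT (ex_intro _ (rcons (s ++ t) a) (ex_intro _ v' (conj hv' erefl)))).
rewrite leqNgt reach_rcons; apply/negP; rewrite negbK.
apply: leq_trans (card_step ust nal) _.
by rewrite {1}/reach foldl_cat; exact: card_foldl_step.
Qed.

End Synchronization.

(** Finite type with memory [K]: membership is decided by the words of length [K + 1]. *)
Definition step_closed {A : finType} (X : set (biseq A)) (K : nat) : Prop :=
  forall x : biseq A, (forall j, exists2 y, X y & agree j (j + K%:Z) x y) -> X x.

Definition transitive_words {A : finType} (X : set (biseq A)) : Prop :=
  forall x y (M : nat), X x -> X y -> exists n : nat, exists z : biseq A,
    [/\ X z, agree (- M%:Z) M%:Z x z & agree (- M%:Z) M%:Z y (shiftz n%:Z z)].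

Section FiniteType.
Context {A : finType} (X : set (biseq A)) (psi : biseq A -> biseq A).
Hypotheses (cX : shift_closed X) (lp : local_endo X psi) (sp : set_surj X X psi).
Variables (K : nat).
Hypothesis stepX : step_closed X K.
Variables (r w rho : nat).
Hypothesis rhoP : forall i, (i < r.+2)%N -> local_map X (iter i psi) rho.
Hypothesis Kw : (K + rho + rho < w)%N.

Local Notation pattern := (pattern psi).

(** The overlap of [w] columns exceeds the memory [K], so the two points splice in row 0. In row [i]
    a column left of the overlap's right end by [rho] sees only [x], one right of its left end by
    [rho] sees only [y], and twice [rho] is less than [w], so every column is of one of these
    kinds. *)
Lemma glue_rows n x y : (n < r.+2)%N -> X x -> X y ->
  pattern n.+1 w x = pattern n.+1 w y ->
  exists2 g, X g & forall i, (i < n.+1)%N ->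
    agreeL (w%:Z - 1) (iter i psi g) (iter i psi x) /\
    agreeR 0 (iter i psi g) (iter i psi y).
Proof.
move=> nr Xx Xy /patternP xy.
pose g : biseq A := fun k => if k <= w%:Z - 1 then x k else y k.
have gx k : k <= w%:Z - 1 -> g k = x k by rewrite /g => ->.
have gy k : 0 <= k -> g k = y k.
  move=> k0; rewrite /g; case: (leP k (w%:Z - 1)) => // kw.
  by apply: (xy 0%N) => //; lia.
have Xg : X g.
  apply: stepX => j; have [j0|j0] := leP 0 j.
    by exists y => // k kj; apply: gy; lia.
  by exists x => // k kj; apply: gx; lia.
exists g => // i ir; have lpi : local_map X (iter i psi) rho by apply: rhoP; lia.
have rx k : k <= w%:Z - 1 - rho%:Z -> iter i psi g k = iter i psi x k.
  by move=> kw; apply: lpi => // l lk; apply: gx; lia.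
have ry k : rho%:Z <= k -> iter i psi g k = iter i psi y k.
  by move=> kw; apply: lpi => // l lk; apply: gy; lia.
split=> k kw.
  have [kr|kr] := leP k (w%:Z - 1 - rho%:Z); first exact: rx.
  by rewrite (xy i) ?ry //; lia.
have [kr|kr] := leP rho%:Z k; first exact: ry.
by rewrite -(xy i) ?rx //; lia.
Qed.

Lemma pat_exists b n v x : X x -> exists t : pat X psi b n v, val t = pattern n v x.
Proof.
move=> Xx; have h : b || `[< occurs X psi (pattern n v x) >].
  by apply/orP; right; apply/asboolP; exists x.
by exists (exist _ (pattern n v x) h).
Qed.

(** The first letters along a path form a point [x] of [X] by finite type, and row 0 of each symbol
    is read from it. An entry in row [i] is looked up in the symbol placed [rho] columns before it,
    where it sits deep enough to depend only on that symbol's row 0. *)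
Lemma paths_code_set n : (n < r.+2)%N ->
  paths (pattern_graph cX lp false n.+1 w) = @code_set _ X psi false n.+1 w.
Proof.
move=> nr; apply/seteqP; split; last exact: code_set_paths.
move=> y py.
have /choice[xx hx] : forall j, exists x, X x /\ val (y j) = pattern n.+1 w.+1 x.
  by move=> j; have [x Xx yx] := pat_occurs (y j); exists x.
have Xxx j : X (xx j) by case: (hx j).
have st j i k : (i < n.+1)%N -> 0 <= k < w%:Z ->
    iter i psi (xx j) (k + 1) = iter i psi (xx (j + 1)) k.
  move=> i_n kw; have /(congr1 val) /= := py j; have [_ ->] := hx j.
  have [_ ->] := hx (j + 1); rewrite (right_cols_pattern lp) // left_cols_pattern.
  move=> /patternP/(_ i i_n k); have [_ _ si] := local_endo_iter i lp.
  by rewrite si // /shiftz; apply; lia.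
have diag j i (k : nat) : (i < n.+1)%N -> (k <= w)%N ->
    iter i psi (xx j) k%:Z = iter i psi (xx (j + k%:Z)) 0.
  move=> i_n; elim: k j => [|k IH] j kw; first by rewrite addr0.
  rewrite -addn1 PoszD st //.
  by rewrite IH; [congr (iter _ _ (xx _) _); lia|lia].
pose x : biseq A := fun j => xx j 0.
have xE j : agree 0 w%:Z (shiftz j x) (xx j).
  move=> k kw; have -> : k = (`|k|%N)%:Z by lia.
  have := diag j 0%N `|k|%N isT ltac:(lia) => /= ->.
  by rewrite /shiftz /x addrC.
have Xx : X x.
  apply: stepX => j; have [sX _] := cX; exists (shiftz (- j) (xx j)); first exact: sX.
  move=> k kj; rewrite /shiftz -xE; last lia.
  by rewrite /shiftz subrK.
exists x; split=> // j; have [_ ->] := hx j; apply/patternP => i i_n k kw.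
have [sX _] := cX.
have -> : k = (`|k|%N)%:Z by lia.
have lpi : local_map X (iter i psi) rho by apply: rhoP; lia.
rewrite diag //; last lia.
have e : iter i psi (xx (j + (`|k|%N)%:Z - rho%:Z)) rho%:Z =
    iter i psi (xx (j + (`|k|%N)%:Z)) 0.
  by rewrite diag ?subrK //; lia.
rewrite -e; set j' := j + _ - _.
have -> : iter i psi (shiftz j x) (`|k|%N)%:Z = iter i psi (shiftz j' x) rho%:Z.
  have [_ _ si] := local_endo_iter i lp; rewrite !si // /shiftz /j'.
  by congr (iter _ _ _ _); lia.
by apply: lpi => // [|l lr]; [exact: sX|rewrite xE //; lia].
Qed.

Lemma top_left_resolving (R : nat) :
  (forall x y, X x -> X y -> agree 0 R%:Z x y ->
    iter r.+1 psi x (-1) = iter r.+1 psi y (-1)) -> (R < w)%N ->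
  left_det X (iter r.+1 psi) 1 ->
  left_resolving (top_hom cX lp false r.+1 w).
Proof.
move=> hR Rw dL u a ua; have pL := top_weakly_left_resolving (cX := cX) (lp := lp) (b := false) hR Rw.
suff [al [al_a al_u]] : exists al, harc (top_hom cX lp false r.+1 w) al = a /\
    ter (pattern_graph cX lp false r.+2 w) al = u.
  exists al; split=> // be [be_a be_u]; apply: pL; first by rewrite al_u.
  by rewrite al_a.
have [sX _] := cX.
have [x Xx ux] := pat_occurs u; have [y Xy ay] := pat_occurs a.
move: ua => /(congr1 val) /=; rewrite ux ay (right_cols_pattern lp) // top_rows_pattern.
move=> /glue_rows[|||g Xg hg] //; first exact: sX.
have [al alg] := pat_exists false r.+2 w.+1 (sX _ Xg (-1)).
exists al; split; apply: val_inj => /=.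
  rewrite alg [RHS]ay top_rows_pattern; apply/patternP => i ir k kw.
  have [_ _ si] := local_endo_iter i lp; have [h _] := hg i ir.
  rewrite si // /shiftz h; last lia.
  by rewrite si // /shiftz subrK.
rewrite alg [RHS]ux (right_cols_pattern lp) ?shiftzNK; last exact: sX.
apply/patternP => i; rewrite ltnS leq_eqVlt => /predU1P[->|ir] k kw.
  (* The last row is not covered by the gluing; it follows from row 0 on the right half-line. *)
  have [_ g0] := hg 0%N isT.
  have := left_detP cX (local_endo_iter r.+1 lp) dL Xg Xx g0.
  by apply; lia.
by have [_ h] := hg i ir; apply: h; lia.
Qed.

Section RightResolving.
Hypothesis qR : weakly_right_resolving (bottom_hom cX lp false r.+1 w).

(** Gluing takes place in the rows of [psi x] and [y], and [g] is a preimage of the glued point. The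
    local inverse of [psi] makes [g] agree with [x] far to the left; since row [r + 1] agrees up to
    column [w - 1], merging extends this to row 0 up to that column. *)
Lemma bottom_right_resolving_injective (t : nat) :
  (forall x y k, X x -> X y ->
     agree (k - t%:Z) (k + t%:Z) (psi x) (psi y) -> x k = y k) ->
  right_merge X (iter r.+1 psi) 1 ->
  right_resolving (bottom_hom cX lp false r.+1 w).
Proof.
move=> pI mR u a ua; have [sX _] := cX.
suff [al [al_a al_u]] : exists al, harc (bottom_hom cX lp false r.+1 w) al = a /\
    ini (pattern_graph cX lp false r.+2 w) al = u.
  exists al; split=> // be [be_a be_u]; apply: qR; first by rewrite al_u.
  by rewrite al_a.
have [mp _ _] := lp.
have [x Xx ux] := pat_occurs u; have [y Xy ay] := pat_occurs a.
move: ua => /(congr1 val) /=; rewrite ux ay left_cols_pattern bottom_rows_pattern.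
move=> /esym /glue_rows[|||v Xv hv] //; first exact: mp.
have [g Xg gv] := sp Xv.
have [al alg] := pat_exists false r.+2 w.+1 Xg.
exists al; split; apply: val_inj => /=.
  rewrite alg [RHS]ay bottom_rows_pattern gv; apply/patternP => i ir k kw.
  by have [_ h] := hv i ir; apply: h; lia.
have gxS : agreeL (w%:Z - 1) (iter r.+1 psi g) (iter r.+1 psi x).
  by rewrite !iterSr gv; have [h _] := hv r (ltnSn r).
have [v0 _] := hv 0%N isT.
have gx0 : agreeL (w%:Z - 1 - t%:Z) g x.
  by move=> k kw; apply: pI => // l lk; rewrite gv; apply: v0; lia.
have gx := right_mergeP cX (local_endo_iter r.+1 lp) mR Xg Xx gx0 gxS.
rewrite alg [RHS]ux left_cols_pattern; apply/patternP => -[_|i ir] k kw.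
  by apply: gx; lia.
by rewrite !iterSr gv; have [h _] := hv i ir; apply: h; lia.
Qed.

Let q := bottom_hom cX lp false r.+1 w.

(* s is the q-label of the path whose last vertex is the pattern of x starting
   at column 0. *)
Let labels (s : seq (pat X psi false r.+1 w.+1)) (x : biseq A) : Prop :=
  map val s = mkseq (fun k => pattern r.+1 w.+1
    (shiftz (k%:Z - (size s)%:Z) (psi x))) (size s).

Let labels_rcons s a x : X x -> labels (rcons s a) x <->
  labels s (shiftz (-1) x) /\ val a = pattern r.+1 w.+1 (psi (shiftz (-1) x)).
Proof.
move=> Xx; have [_ _ sp'] := lp; rewrite /labels map_rcons size_rcons mkseqS.
have e1 : (size s)%:Z - (size s).+1%:Z = -1 by lia.
have e2 (k : nat) : k%:Z - (size s)%:Z + -1 = k%:Z - (size s).+1%:Z by lia.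
rewrite !sp' // e1; split=> [/rcons_inj[h1 h2]|[h1 h2]].
  split; last exact: h2.
  by rewrite h1; apply: eq_mkseq => k; rewrite shiftzD e2.
congr rcons; last exact: h2.
by rewrite h1; apply: eq_mkseq => k; rewrite shiftzD e2.
Qed.

Let labels_agree s x y : X x -> X y ->
  (forall i, (i < r.+1)%N ->
     agreeL (w%:Z - 1) (iter i psi (psi x)) (iter i psi (psi y))) ->
  labels s x -> labels s y.
Proof.
move=> Xx Xy xy; rewrite /labels => ->; have [mp _ _] := lp.
apply/eq_in_map => k; rewrite mem_iota add0n => /andP[_ ks].
apply/patternP => i ir l lw; have [_ _ si] := local_endo_iter i lp.
rewrite !si; [|exact: mp|exact: mp]; rewrite /shiftz; apply: xy => //; lia.
Qed.

(** Gluing absorbs the arcs of a path one after the other, so a single point of [X] realises the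
    whole label. Together with the converse below, paths can be replaced by points when only labels
    and end vertices matter. *)
Let reach_labels s u : u \in reach q s -> exists x,
  [/\ X x, val u = pattern r.+2 w x & labels s x].
Proof.
have [sX _] := cX.
elim/last_ind: s u => [|s a IH] u.
  by have [x Xx ux] := pat_occurs u; exists x.
rewrite reach_rcons => /imsetP[al +]; rewrite inE => /andP[/IH[x [Xx alx sx]] /eqP al_a] u_al.
have [y Xy aly] := pat_occurs al.
move: alx; rewrite /= aly left_cols_pattern.
move=> /esym /glue_rows[|||g Xg hg] //.
exists (shiftz 1 g); split; first exact: sX.
  rewrite u_al /= aly (right_cols_pattern lp) //; apply/patternP => i ir k kw.
  have [_ _ si] := local_endo_iter i lp; rewrite !si // /shiftz.
  by have [_ h] := hg i ir; rewrite h //; lia.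
apply/labels_rcons; first exact: sX.
rewrite shiftzK; split.
  apply: (labels_agree Xx Xg) sx => i ir k kw; rewrite -!iterSr.
  by have [h _] := hg i.+1 ir; rewrite h.
rewrite -al_a /= aly bottom_rows_pattern; apply/patternP => i ir k kw.
by rewrite -!iterSr; have [_ h] := hg i.+1 ir; rewrite h //; lia.
Qed.

Let labels_reach s x : X x -> labels s x -> exists2 u, u \in reach q s &
  val u = pattern r.+2 w x.
Proof.
have [sX _] := cX.
elim/last_ind: s x => [|s a IH] x Xx.
  by have [u ux] := pat_exists false r.+2 w Xx; exists u => //; rewrite inE.
move=> /(labels_rcons _ _ Xx)[/(IH _ (sX _ Xx _))[u us ux] ax].
have [al alx] := pat_exists false r.+2 w.+1 (sX _ Xx (-1)).
exists (ter (pattern_graph cX lp false r.+2 w) al).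
  rewrite reach_rcons; apply/imsetP; exists al => //; rewrite inE; apply/andP; split.
    suff -> : ini (pattern_graph cX lp false r.+2 w) al = u by [].
    by apply: val_inj; rewrite /= alx left_cols_pattern.
  by apply/eqP/val_inj; rewrite /= alx bottom_rows_pattern.
by rewrite /= alx (right_cols_pattern lp) ?shiftzNK //; exact: sX.
Qed.

Let walk n x : X x -> exists s, forall (E : {set pat X psi false r.+2 w}) v u,
  v \in E -> val v = pattern r.+2 w x -> val u = pattern r.+2 w (shiftz n%:Z x) ->
  u \in foldl (step q) E s.
Proof.
have [sX _] := cX; elim: n x => [|n IH] x Xx.
  exists [::] => E v u vE vx; rewrite shiftz0 => ux.
  by have <- : v = u by apply: val_inj; rewrite vx.
have [s hs] := IH _ (sX _ Xx 1).
have [al alx] := pat_exists false r.+2 w.+1 Xx.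
exists (harc q al :: s) => E v u vE vx ux /=.
apply: (hs _ (ter (pattern_graph cX lp false r.+2 w) al)).
- apply/imsetP; exists al => //; rewrite inE eqxx andbT.
  suff -> : ini (pattern_graph cX lp false r.+2 w) al = v by [].
  by apply: val_inj; rewrite [RHS]vx /= alx left_cols_pattern.
- by rewrite /= alx (right_cols_pattern lp).
- by rewrite ux shiftzD; have -> : n%:Z + 1 = n.+1%:Z by lia.
Qed.

(** The preimage [g] of the glued point may differ from [x] in row 0, so the vertex it reaches may
    not follow [u]. Labels depend on [psi g] alone, however, so [rcons s a] still labels some path,
    which is what the counting argument asks for. *)
Lemma bottom_right_resolving_transitive : transitive_words X ->
  right_resolving (bottom_hom cX lp false r.+1 w).
Proof.
move=> trX; have [sX _] := cX; have [mp _ _] := lp.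
apply: right_resolving_of_lifts => // [v u|s u a us ua].
  have [x Xx vx] := pat_occurs v; have [y Xy uy] := pat_occurs u.
  have [n [z [Xz xz yz]]] := trX x y (w + rho)%N Xx Xy.
  have [s hs] := walk n Xz; exists s => E vE; apply: hs vE _ _.
    rewrite vx; apply/patternP => i ir k kw; apply: (rhoP ir) => // l lk.
    by apply: xz; lia.
  rewrite uy; apply/patternP => i ir k kw; apply: (rhoP ir) => // [|l lk].
    exact: sX.
  by apply: yz; lia.
have [x [Xx ux sx]] := reach_labels us.
have [y Xy ay] := pat_occurs a.
move: ua => /(congr1 val) /=; rewrite ux ay left_cols_pattern bottom_rows_pattern.
move=> /esym /glue_rows[|||v Xv hv] //; first exact: mp.
have [g Xg gv] := sp Xv.
suff /(labels_reach (sX _ Xg 1))[u' u's _] : labels (rcons s a) (shiftz 1 g) by exists u'.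
apply/labels_rcons; first exact: sX.
rewrite shiftzK; split.
  apply: (labels_agree Xx Xg) sx => i ir k kw; rewrite gv.
  by have [h _] := hv i ir; rewrite h.
rewrite gv ay; apply/patternP => i ir k kw.
by have [_ h] := hv i ir; rewrite h //; lia.
Qed.

End RightResolving.

End FiniteType.

Lemma code_set_textile_base {A : finType} (X : set (biseq A)) psi
    (cX : shift_closed X) (lp : local_endo X psi) r w :
  set_surj X X psi ->
  @code_set _ X psi false r.+1 w `<=`
    textile_base (top_hom cX lp false r w) (bottom_hom cX lp false r w).
Proof.
move=> sp z [x cx]; have [Xx _] := cx; have [mp _ _] := lp.
have [xs [Xxs oxs] xs0] := biorbit_exists sp mp Xx.
have /choice[zs hzs] : forall i, exists zi, @coded _ X psi false r.+1 w (xs i) zi.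
  by move=> i; exact: coded_exists.
exists zs; split.
- by move=> i; apply: code_set_paths; exists (xs i).
- by apply: coded_fun cx; rewrite -xs0.
- move=> i; apply: (coded_fun (x := xs i)); last exact: coded_top.
  by have := coded_bottom cX lp false (hzs (i - 1)); rewrite oxs subrK.
Qed.

Lemma LR_code {A : finType} (X : set (biseq A)) psi (cX : shift_closed X)
    (lp : local_endo X psi) K :
  set_surj X X psi -> step_closed X K -> LR_hyperbolic X psi ->
  set_inj X psi \/ transitive_words X ->
  exists r w, [/\ Defs.nondegenerate (pattern_graph cX lp false r.+1 w),
    paths (pattern_graph cX lp false r.+1 w) = @code_set _ X psi false r.+1 w &
    resolving LR (pattern_graph cX lp false r.+1 w) (@code_map _ X psi false r w)].
Proof.
move=> sp stepX /(LR_hyperbolic_common cX lp)[[|r] [// _ dL mR]] inj_tr.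
have lS := local_endo_iter r.+1 lp; have [sX _] := cX.
have [R hR] := left_det_window cX lS dL.
have [D hD] := right_merge_window cX lS mR.
have [rho hrho] := local_map_iters lp r.+2.
(* Wide enough for both determination windows and for gluing in all rows. *)
pose w := (R + D + K + rho + rho).+1; exists r, w.
have Kw : (K + rho + rho < w)%N by rewrite /w; lia.
have pE n : (n < r.+2)%N -> paths (pattern_graph cX lp false n.+1 w) =
    @code_set _ X psi false n.+1 w by exact: (paths_code_set cX lp stepX hrho Kw).
have cc := conjugacy_code cX lp false r w.
have lp' := conjugacy_local_endo cc lp.
(* The base contains every coded point by surjectivity and consists of paths, which are coded points
   by finite type. *)
have baseE : textile_base (top_hom cX lp false r.+1 w) (bottom_hom cX lp false r.+1 w)
    = @code_set _ X psi false r.+2 w.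
  apply/seteqP; split; last exact: code_set_textile_base.
  by move=> z [zs [pz <- _]]; rewrite -pE.
have qR : weakly_right_resolving (bottom_hom cX lp false r.+1 w).
  by apply: bottom_weakly_right_resolving hD _; rewrite /w; lia.
split.
- split=> u; have [x Xx ux] := pat_occurs u.
    have [t tx] := pat_exists psi false r.+1 w.+1 Xx; exists t.
    by apply: val_inj; rewrite /= tx left_cols_pattern [RHS]ux.
  have [t tx] := pat_exists psi false r.+1 w.+1 (sX _ Xx (-1)); exists t.
  apply: val_inj; rewrite /= tx (right_cols_pattern lp) ?shiftzNK; last exact: sX.
  by rewrite [RHS]ux.
- exact: pE.
split.
- by rewrite pE //; exact: local_endomorphism.
- by rewrite pE //; exact: conjugacy_surj cc sp.
exists (pat X psi false r.+2 w.+1), (pattern_graph cX lp false r.+2 w),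
  (top_hom cX lp false r.+1 w), (bottom_hom cX lp false r.+1 w).
rewrite baseE pE //; split.
- split.
    by apply: (top_left_resolving stepX hrho Kw hR _ dL); rewrite /w; lia.
  case: inj_tr => [ip|tr].
    have [_ [s ls] sps] := lp.
    have [t ht] := injective_local cX ls sps ip.
    exact: (bottom_right_resolving_injective sp stepX hrho Kw qR ht mR).
  exact: (bottom_right_resolving_transitive sp stepX hrho Kw qR tr).
- exact: code_top_bij.
- by move=> z; exact: code_map_induced.
Qed.

Lemma weakly_resolving_LR {A : finType} (X : set (biseq A)) psi :
  shift_closed X -> weakly_resolving LR X psi ->
  left_det X psi 0 /\ right_merge X psi 0.
Proof.
move=> cX [_ [B [Gam [G [p [q [Z [[pL qR] [clZ sZ Zp] pZ _ psiE]]]]]]]].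
have cZ := shift_closed_of clZ sZ; split.
  exact: (weakly_LR_left_det cZ Zp pZ psiE pL).
exact: (weakly_LR_right_merge cZ Zp pZ psiE qR).
Qed.

Lemma resolving_LR {A : finType} (G : graph A) psi : resolving LR G psi ->
  left_det (paths G) psi 0 /\ right_merge (paths G) psi 0.
Proof.
move=> [_ _ [B [Gam [p [q [[pL qR] pZ psiE]]]]]].
have cZ := shift_closed_textile_base p q.
have Zp : textile_base p q `<=` paths Gam by move=> z [zs [pz <- _]].
have pL' : weakly_left_resolving p.
  move=> al be ab pab; have [c [_ uc]] := pL (ter Gam al) (harc p al) (hom_ter p al).
  by rewrite -(uc al) ?(uc be) // pab ab.
have qR' : weakly_right_resolving q.
  move=> al be ab qab; have [c [_ uc]] := qR (ini Gam al) (harc q al) (hom_ini q al).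
  by rewrite -(uc al) ?(uc be) // qab ab.
split; first exact: (weakly_LR_left_det cZ Zp pZ psiE pL').
exact: (weakly_LR_right_merge cZ Zp pZ psiE qR').
Qed.

Section LRTheorem.
Context {A : finType} (X : set (biseq A)) (psi : biseq A -> biseq A).
Hypotheses (cX : shift_closed X) (lp : local_endo X psi) (sp : set_surj X X psi).

Lemma essentially_weakly_LR_iff : (1 < #|A|)%N ->
  essentially_weakly LR X psi /\ (exists M, expansive_width X psi M) <->
  LR_hyperbolic X psi.
Proof.
move=> A1; have [mp _ _] := lp; split; last first.
  move=> hyp; split; last exact: LR_hyperbolic_expansive.
  have [r [w [sX' wX']]] := weakly_LR_code cX lp A1 hyp.
  have [th [hth ths thp]] := homeomorphism_of_conjugacy (conjugacy_code cX lp true r w).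
  by exists (pat X psi true r.+1 w.+1), (@code_set _ X psi true r.+1 w),
    (@code_map _ X psi true r w), th.
move=> [[A' [X' [psi' [th [sX' wX' hth ths thp]]]]] [M eM]].
have cX' := subshift_shift_closed sX'.
have [F cF] := conjugacy_of_homeomorphism cX cX' mp hth ths thp.
have lp' := conjugacy_local_endo cF lp.
have [dL mR] := weakly_resolving_LR cX' wX'.
exact: (conjugacy_LR_hyperbolic cX cX' lp lp' sp eM cF).
Qed.

Lemma essentially_LR_iff K : step_closed X K ->
  set_inj X psi \/ transitive_words X ->
  essentially LR X psi /\ (exists M, expansive_width X psi M) <->
  LR_hyperbolic X psi.
Proof.
move=> stepX inj_tr; have [mp _ _] := lp; split; last first.
  move=> hyp; split; last exact: LR_hyperbolic_expansive.
  have [r [w [nG pG rG]]] := LR_code cX lp sp stepX hyp inj_tr.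
  have := conjugacy_code cX lp false r w; rewrite -pG => cc.
  have [th [hth ths thp]] := homeomorphism_of_conjugacy cc.
  by exists (pat X psi false r.+1 w.+1), (pattern_graph cX lp false r.+1 w),
    (@code_map _ X psi false r w), th.
move=> [[A' [G [psi' [th [nG rG hth ths thp]]]]] [M eM]].
have cG := shift_closed_paths G.
have [F cF] := conjugacy_of_homeomorphism cX cG mp hth ths thp.
have lp' := conjugacy_local_endo cF lp.
have [dL mR] := resolving_LR rG.
exact: (conjugacy_LR_hyperbolic cX cG lp lp' sp eM cF).
Qed.

End LRTheorem.

(** * Reflection, and the theorem *)

Definition dual (P : resolving_kind) : resolving_kind :=
  match P with LR => RL | RL => LR end.

Definition flip_graph {A : finType} (G : graph A) : graph A :=
  @Graph A (vert G) (@ter A G) (@ini A G).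

Definition flip_hom {B A : finType} {Gam : graph B} {G : graph A}
    (h : graph_hom Gam G) : graph_hom (flip_graph Gam) (flip_graph G) :=
  @GraphHom B A (flip_graph Gam) (flip_graph G) (harc h) (hvert h)
    (hom_ter h) (hom_ini h).

Lemma paths_flip {A : finType} (G : graph A) :
  paths (flip_graph G) = flip_set (paths G).
Proof.
apply/seteqP; split=> x xp j; have := xp (- (j + 1)); rewrite /flip /=.
  by have -> : - (j + 1) + 1 = - j by lia.
have -> : - (- (j + 1) + 1) = j by lia.
by rewrite opprK.
Qed.

Lemma textile_base_flip {B A : finType} (Gam : graph B) (G : graph A)
    (p q : graph_hom Gam G) :
  textile_base (flip_hom p) (flip_hom q) = flip_set (textile_base p q).
Proof.
have key (C D : finType) (Gm : graph C) (H : graph D) (p' q' : graph_hom Gm H) z :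
    textile_base p' q' z -> textile_base (flip_hom p') (flip_hom q') (flip z).
  move=> [zs [pz z0 qp]]; exists (fun i => flip (zs i)); split.
  - by move=> i; rewrite paths_flip; exact: flip_setE (pz i).
  - by rewrite z0.
  - by move=> i; apply/funext => k; exact: (congr1 (fun w : biseq D => w (- k)) (qp i)).
apply/seteqP; split=> z; last by move=> /key; rewrite flipK.
move=> /key; rewrite /flip_set /=.
(* Reversing arcs twice gives back the textile system once its records are taken apart. *)
by case: p q => [pa pv pi pt] [qa qv qi qt]; case: Gam G pv pi pt qv qi qt => [? ? ?] [? ? ?].
Qed.

Lemma set_bij_flip {B A : finType} (Gam : graph B) (G : graph A)
    (h : graph_hom Gam G) (Z : set (biseq B)) (X : set (biseq A)) :
  set_bij Z X (Defs.induced h) ->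
  set_bij (flip_set Z) (flip_set X) (Defs.induced (flip_hom h)).
Proof.
move=> [hf hi hs]; split.
- by move=> z Zz; exact: (hf _ Zz).
- move=> z z' /set_mem Zz /set_mem Zz' e; apply: (can_inj flipK).
  apply: hi; [exact/mem_set|exact/mem_set|].
  exact: (congr1 flip e).
- move=> x /hs[z Zz zx]; exists (flip z); first exact: flip_setE.
  by apply: (can_inj flipK); rewrite -zx; apply/funext => k; rewrite /flip /Defs.induced opprK.
Qed.

Lemma weakly_textile_flip P {B A : finType} (Gam : graph B) (G : graph A)
    (p q : graph_hom Gam G) :
  weakly_textile P p q -> weakly_textile (dual P) (flip_hom p) (flip_hom q).
Proof. by case: P. Qed.

Lemma textile_flip P {B A : finType} (Gam : graph B) (G : graph A)
    (p q : graph_hom Gam G) :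
  textile P p q -> textile (dual P) (flip_hom p) (flip_hom q).
Proof. by case: P. Qed.

Lemma subshift_flip {A : finType} (X : set (biseq A)) :
  subshift X -> subshift (flip_set X).
Proof.
move=> sX; have [A1 _ _] := sX.
have [clX sX'] := closed_of_shift_closed (shift_closed_flip (subshift_shift_closed sX)).
by split.
Qed.

Lemma weakly_resolving_flip P {A : finType} (X : set (biseq A)) psi :
  shift_closed X -> weakly_resolving P X psi ->
  weakly_resolving (dual P) (flip_set X) (flip_map psi).
Proof.
move=> cX [ep [B [Gam [G [p [q [Z [T [clZ sZ Zp] pZ qZ psiE]]]]]]]].
split; first exact/local_endomorphism/local_endo_flip/endomorphism_local.
exists B, (flip_graph Gam), (flip_graph G), (flip_hom p), (flip_hom q), (flip_set Z).
split.
- exact: weakly_textile_flip.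
- have [h1 h2] := closed_of_shift_closed (shift_closed_flip (shift_closed_of clZ sZ)).
  by split=> // z Zz; rewrite paths_flip; exact: (Zp _ Zz).
- exact: set_bij_flip.
- by move=> _ [z Zz <-]; apply: qZ; exists (flip z).
- by move=> z /psiE pz; rewrite /flip_map -[RHS]flipK; congr flip.
Qed.

Lemma resolving_flip P {A : finType} (G : graph A) psi :
  resolving P G psi -> resolving (dual P) (flip_graph G) (flip_map psi).
Proof.
move=> [ep sp [B [Gam [p [q [T pZ psiE]]]]]]; split.
- rewrite paths_flip; apply/local_endomorphism/local_endo_flip/endomorphism_local => //.
  exact: shift_closed_paths.
- by rewrite paths_flip; exact: surj_flip.
exists B, (flip_graph Gam), (flip_hom p), (flip_hom q); split.
- exact: textile_flip.
- by rewrite textile_base_flip paths_flip; exact: set_bij_flip.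
- by rewrite textile_base_flip => z /psiE pz; rewrite /flip_map -[RHS]flipK; congr flip.
Qed.

Lemma essentially_weakly_flip P {A : finType} (X : set (biseq A)) psi :
  shift_closed X -> (forall x, X x -> X (psi x)) ->
  essentially_weakly P X psi ->
  essentially_weakly (dual P) (flip_set X) (flip_map psi).
Proof.
move=> cX mp [A' [X' [psi' [th [sX' wX' hth ths thp]]]]].
have cX' := subshift_shift_closed sX'.
have [F cF] := conjugacy_of_homeomorphism cX cX' mp hth ths thp.
have [th' [hth' ths' thp']] := homeomorphism_of_conjugacy (conjugacy_flip cF).
exists A', (flip_set X'), (flip_map psi'), th'; split=> //.
  exact: subshift_flip.
exact: weakly_resolving_flip.
Qed.

Lemma essentially_flip P {A : finType} (X : set (biseq A)) psi :
  shift_closed X -> (forall x, X x -> X (psi x)) ->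
  essentially P X psi -> essentially (dual P) (flip_set X) (flip_map psi).
Proof.
move=> cX mp [A' [G [psi' [th [nG rG hth ths thp]]]]].
have cG := shift_closed_paths G.
have [F cF] := conjugacy_of_homeomorphism cX cG mp hth ths thp.
have := conjugacy_flip cF; rewrite -paths_flip => cF'.
have [th' [hth' ths' thp']] := homeomorphism_of_conjugacy cF'.
exists A', (flip_graph G), (flip_map psi'), th'; split=> //.
  by have [n1 n2] := nG.
exact: resolving_flip.
Qed.

Section Duality.
Context {A : finType} (X : set (biseq A)) (psi : biseq A -> biseq A).
Hypotheses (cX : shift_closed X) (mp : forall x, X x -> X (psi x)).

Let mp' x : flip_set X x -> flip_set X (flip_map psi x).
Proof. by move=> /mp Xx; exact: flip_setE. Qed.

Lemma essentially_weakly_RL : essentially_weakly RL X psi <->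
  essentially_weakly LR (flip_set X) (flip_map psi).
Proof.
split=> [|h]; first exact: (@essentially_weakly_flip RL).
have := essentially_weakly_flip (shift_closed_flip cX) mp' h.
by rewrite flip_setK flip_mapK.
Qed.

Lemma essentially_RL : essentially RL X psi <->
  essentially LR (flip_set X) (flip_map psi).
Proof.
split=> [|h]; first exact: (@essentially_flip RL).
have := essentially_flip (shift_closed_flip cX) mp' h.
by rewrite flip_setK flip_mapK.
Qed.

Lemma expansive_width_flipE : (exists M, expansive_width X psi M) <->
  (exists M, expansive_width (flip_set X) (flip_map psi) M).
Proof.
split=> -[M hM]; exists M; first exact: expansive_width_flip.
by have := expansive_width_flip hM; rewrite flip_setK flip_mapK.
Qed.

End Duality.

(** At every column some point of [X] looks like [x] nearby; its code is kept at that column. Codes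
    chosen at close columns coincide there, so the kept arcs form a path, and decoding this path
    gives [x]. *)
Lemma step_closed_SFT {A : finType} (X : set (biseq A)) :
  SFT X -> exists K, step_closed X K.
Proof.
move=> [sX [A' [G [th [_ hth ths]]]]].
have cX := subshift_shift_closed sX; have [shX _] := cX.
have [F cF] := conjugacy_of_homeomorphism cX (shift_closed_paths G)
  (fun x Xx => shX x Xx 1) hth ths ths.
have [FX Fin Fsur [r hr] _] := cF.
(* Codes are compared at distance at most [r + 1] (1 for consecutive arcs, [r] for decoding), and
   each comparison looks [r] columns further: half a window is [r + r + 1]. *)
exists (r + r + 1 + (r + r + 1))%N => x hx.
have /choice[u hu] : forall j : int, exists u : biseq A * biseq A',
    F u.1 u.2 /\ agree (j - (r + r + 1)%N%:Z) (j + (r + r + 1)%N%:Z) x u.1.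
  move=> j; have [y Xy xy] := hx (j - (r + r + 1)%N%:Z).
  have [y' Fy] := Fin _ Xy; exists (y, y'); split=> // k kj; apply: xy; lia.
pose y : biseq A' := fun j => (u j).2 j.
have near j l : (`|(j - l)%R| <= r + 1)%N -> (u j).2 l = y l.
  move=> jl; have [Fj xj] := hu j; have [Fl xl] := hu l.
  have [h _] := hr _ _ _ _ l Fj Fl; apply: h => k kl.
  by rewrite -xj -?xl //; lia.
have py : paths G y.
  move=> j; have [Fj _] := hu j; have [_ pj] := FX _ _ Fj.
  by rewrite /y (pj j) near //; lia.
have [z Fz] := Fsur y py; suff -> : x = z by have [] := FX _ _ Fz.
apply/funext => k; have [Fk xk] := hu k; rewrite xk; last lia.
have [_ h] := hr _ _ _ _ k Fk Fz; apply: h => l lk; apply: near; lia.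
Qed.

Lemma step_closed_flip {A : finType} (X : set (biseq A)) K :
  step_closed X K -> step_closed (flip_set X) K.
Proof.
move=> h x hx; apply: h => j; have [y Xy xy] := hx (- (j + K%:Z)).
by exists (flip y) => //; apply/agree_flip => k kj; apply: xy; lia.
Qed.

Lemma transitive_words_of {A : finType} (X : set (biseq A)) :
  transitive_shift X -> transitive_words X.
Proof.
move=> tr x y M Xx Xy.
have := cyl_nbhs x M; rewrite nbhsE => -[U [oU Ux] UM].
have := cyl_nbhs y M; rewrite nbhsE => -[V [oV Vy] VM].
have [n [_ [[z [Xz Uz] <-] Vz]]] := tr U V oU oV (ex_intro _ x (conj Xx Ux))
  (ex_intro _ y (conj Xy Vy)).
exists n, z; split; [by []|exact: UM|rewrite -iter_shift; exact: VM].
Qed.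

(** Reflection reverses the order in which the two words occur, so transitivity is applied to [y]
    and [x] in exchanged roles. *)
Lemma transitive_words_flip {A : finType} (X : set (biseq A)) :
  shift_closed X -> transitive_words X -> transitive_words (flip_set X).
Proof.
move=> [sX _] tr x y M Xx Xy; have [n [z [Xz yz xz]]] := tr _ _ M Xy Xx.
exists n, (flip (shiftz n%:Z z)); split.
- by apply: flip_setE; exact: sX.
- rewrite -[x]flipK; apply/agree_flip => k kM; apply: xz; lia.
- rewrite flip_shiftz shiftzNK -[y]flipK; apply/agree_flip => k kM; apply: yz; lia.
Qed.

Theorem theorem9p10 (R : realType) (A : finType) (X : set (biseq A))
    (hX : subshift X)
    (d : biseq A -> biseq A -> R) (hd : compatible_metric X d)
    (phi : biseq A -> biseq A) (hphi : endomorphism X phi)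
    (honto : set_surj X X phi)
    (i : nat) (hi : (0 < i)%N) (j : int) :
  let psi := fun x : biseq A => iter i phi (shiftz j x) in
  let slope : \bar R := (j%:~R / i%:R)%:E in
  ((essentially_weakly LR X psi /\ expansive X d psi <->
      (cR X R phi < slope)%E) /\
   (essentially_weakly RL X psi /\ expansive X d psi <->
      (slope < cL X R phi)%E)) /\
  (SFT X -> set_inj X phi \/ transitive_shift X ->
   (essentially LR X psi /\ expansive X d psi <->
      (cR X R phi < slope)%E) /\
   (essentially RL X psi /\ expansive X d psi <->
      (slope < cL X R phi)%E)).
Proof.
move=> psi slope.
have cX := subshift_shift_closed hX; have [A1 _ _] := hX; have [sX _] := cX.
have lphi := endomorphism_local cX hphi.
have lp : local_endo X psi := local_endo_mix cX lphi i j.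
have [mp _ _] := lp.
have sp : set_surj X X psi.
  move=> x Xx; have [y Xy yx] := surj_iter i honto Xx.
  by exists (shiftz (- j) y); [exact: sX|rewrite /psi shiftzNK].
have cX' := shift_closed_flip cX; have lp' := local_endo_flip lp.
have sp' := surj_flip sp.
rewrite !(expansive_widthP cX hd) (cR_hyperbolic (R := R) cX lphi j hi).
rewrite (cL_hyperbolic (R := R) cX lphi j hi) -/psi.
rewrite (essentially_weakly_RL cX mp) (essentially_RL cX mp).
split.
  split; first exact: essentially_weakly_LR_iff.
  by rewrite expansive_width_flipE; exact: essentially_weakly_LR_iff.
move=> /step_closed_SFT[K stepX] inj_tr.
have {}inj_tr : set_inj X psi \/ transitive_words X.
  case: inj_tr => [ip|/transitive_words_of]; [left|by right].
  have ipi n : set_inj X (iter n phi).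
    have [mphi _ _] := lphi.
    elim: n => // n IH x y /set_mem Xx /set_mem Xy; rewrite !iterS => e.
    have [mn _ _] := local_endo_iter n lphi.
    by apply: IH; [exact/mem_set|exact/mem_set|];
      apply: ip => //; apply/mem_set; exact: mn.
  move=> x y /set_mem Xx /set_mem Xy e; apply: (can_inj (@shiftzK A j)).
  by apply: (ipi i) => //; apply/mem_set; exact: sX.
split; first exact: (essentially_LR_iff cX lp sp stepX inj_tr).
rewrite expansive_width_flipE.
apply: (essentially_LR_iff cX' lp' sp' (step_closed_flip stepX)).
case: inj_tr => [ip|tr]; [left; exact: inj_flip|right; exact: transitive_words_flip].
Qed.
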